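(* Let $\sigma_1,\ldots,\sigma_n, \omega$ be weights on $\mathbb{R}^{d}$, and let $\Phi_1,\dots,\Phi_{n} \in \mathcal{U} \cap \nabla_{2}$ and $\Psi\in \widetilde{\mathcal{U}}$. Define $$[ \vec{\sigma},\omega]_{K_{\vec {\Phi},\Psi}}:=\sup_{Q\in \mathcal Q}\omega(Q)\left(\prod_{i=1}^n\Psi\circ\Phi_i^{-1}\left(\frac{1}{\sigma_i(Q)}\right)\right).$$ If for each $1 \leq i \leq n$ the function $t\mapsto\frac{\Psi(t)}{\Phi_i(t)}$ is nondecreasing on $\mathbb{R}^{*}_{+}$ and $\sigma_{i}$ is doubling, then $\mathcal{M}_{\vec{\sigma}}$ is bounded from $L^{\Phi_1}(\sigma_1)\times\cdots\times L^{\Phi_n}(\sigma_n)$ to $L^\Psi(\omega)$ if and only if $[ \vec{\sigma},\omega]_{K_{\vec {\Phi},\Psi}}$ is finite. Moreover, $$\|\mathcal{M}_{\vec{\sigma}}\|_{\prod_{i=1}^{n}L_{\sigma_i}^{\Phi_{i}}\to L_{\omega}^{\Psi}} \approx \Psi^{-1}\left( [\vec{\sigma},\omega]_{K_{\vec{\Phi},\Psi}}\right).$$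
   Context: $\mathbb{R}_+=[0,\infty)$, $\mathbb{R}_+^*=(0,\infty)$. $\mathcal{Q}$ is the set of non-degenerate cubes in $\mathbb{R}^d$ with sides parallel to the axes; $\ell(Q)$ is the sidelength of $Q$. A weight is a locally integrable, almost everywhere positive function $\sigma$ on $\mathbb{R}^d$; $\sigma(E)=\int_E\sigma(x)\,dx$. A weight $\sigma$ is doubling if there is $C>1$ such that for all $Q,Q'\in\mathcal{Q}$ with $Q\subset Q'$, $\ell(Q')\le2\ell(Q)$ implies $\sigma(Q')\le C\sigma(Q)$. The weighted multilinear maximal function, with $\vec\sigma=(\sigma_1,\dots,\sigma_n)$, is $$\mathcal{M}_{\vec{\sigma}}(f_1,\dots,f_n)(x):= \sup_{Q \in \mathcal{Q}}\prod_{i=1}^{n}\frac{\chi_{Q}(x)}{\sigma_{i}(Q)}\int_{Q}|f_{i}(y)|\sigma_{i}(y)\,dy .$$ A growth function is a function $\Phi:\mathbb{R}_+\to\mathbb{R}_+$, not identically zero, continuous, nondecreasing and onto. It is of upper-type $q>0$ if there is $C_q>0$ with $\Phi(st)\le C_q t^q\Phi(s)$ for all $s>0$, $t\ge 1$. For $q\ge1$, $\mathcal{U}^q$ is the set of growth functions of upper-type $q$ such that $t\mapsto\Phi(t)/t$ is nondecreasing on $\mathbb{R}_+^*$; $\mathcal{U}=\bigcup_{q\ge1}\mathcal{U}^q$. Standing convention: (up to replacing it by an equivalent function) every $\Phi\in\mathcal{U}$ is assumed convex, of class $C^1$, with $\Phi'(t)\approx\Phi(t)/t$ for $t>0$. $\Phi\in\Delta'$: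 there is $C>0$ with $\Phi(st)\le C\Phi(s)\Phi(t)$ for all $s,t>0$. $\Phi\in\Delta_2$: there is $K>0$ with $\Phi(2t)\le K\Phi(t)$ for all $t>0$. For a convex growth function $\Phi\in\Delta_2$, $\Phi\in\nabla_2$ means there is $C>0$ with $\int_0^t\frac{\Phi(s)}{s^2}ds\le C\frac{\Phi(t)}{t}$ for all $t>0$. For $q\ge1$, $\widetilde{\mathcal{U}}^q$ is the set of $\Phi\in\mathcal{U}^q\cap\Delta'$ for which there is $C>0$ with $\Phi(s/t)\le C\,\Phi(s)/t^q$ for all $s,t\ge1$; $\widetilde{\mathcal{U}}=\bigcup_{q\ge1}\widetilde{\mathcal{U}}^q$. For $\Phi\in\mathcal{U}$ and a weight $\sigma$, $L^\Phi(\sigma)$ is the set of (classes of) measurable $f:\mathbb{R}^d\to\mathbb{C}$ with $\|f\|_{L^\Phi_\sigma}^{lux}:=\inf\{\lambda>0:\int_{\mathbb{R}^d}\Phi(|f(x)|/\lambda)\sigma(x)dx\le1\}<\infty$. An operator $T:L^{\Phi_1}(\sigma_1)\times\cdots\times L^{\Phi_n}(\sigma_n)\to L^\Psi(\omega)$ is bounded if there is $C>0$ with $\|T(f_1,\dots,f_n)\|^{lux}_{L^\Psi_\omega}\le C\prod_{j}\|f_j\|^{lux}_{L^{\Phi_j}_{\sigma_j}}$ for all $f_j\in L^{\Phi_j}(\sigma_j)$; $\|T\|_{\prod_j L^{\Phi_j}_{\sigma_j}\to L^\Psi_\omega}$ is the infimum of such $C$. $A\approx B$ means $c^{-1}B\le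 A\le cB$ with a constant $c>0$ depending only on $n$, $\sigma_1,\dots,\sigma_n$, $\Psi$, $\Phi_1,\dots,\Phi_n$ (not on $\omega$). *)

(* Defs.v *)
From HB Require Import structures.
From mathcomp Require Import all_boot all_order all_algebra.
From mathcomp Require Import all_classical all_reals all_analysis.
From mathcomp Require Import complex.

Set Implicit Arguments.
Unset Strict Implicit.
Unset Printing Implicit Defensive.
Import Order.TTheory GRing.Theory Num.Theory.
Import numFieldNormedType.Exports.

Local Open Scope classical_set_scope.
Local Open Scope ring_scope.

(* Lebesgue measure on the Borel sets of d-tuples is built by recursion on d:
   the measure in dimension d.+1 is the image under (x, t) |-> x :: t of the
   product of the one-dimensional measure with the measure in dimension d. *)
Section borel_lebesgue.
Context {R : realType}.
Local Notation btuple d := (d.-tuple (measurableTypeR R)).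

Definition consp d (p : measurableTypeR R * btuple d) : btuple d.+1 :=
  [the d.+1.-tuple (measurableTypeR R) of p.1 :: p.2].

Lemma measurable_consp d : measurable_fun setT (@consp d).
Proof.
apply: (measurable_cons (f := fst) (g := snd)).
  exact: measurable_fst.
exact: measurable_snd.
Qed.

Section step.
Context d (mu : {sigma_finite_measure set (btuple d) -> \bar R}).

Definition leb_step : set (btuple d.+1) -> \bar R :=
  pushforward (@lebesgue_measure R \x mu)%E (@consp d).

Let leb_step0 : leb_step set0 = 0%E.
Proof. by rewrite /leb_step /pushforward preimage_set0 measure0. Qed.

Let leb_step_ge0 A : (0 <= leb_step A)%E.
Proof. by rewrite /leb_step /pushforward. Qed.

Let leb_step_sigma_additive : semi_sigma_additive leb_step.
Proof.
move=> F mF tF mUF; rewrite /leb_step /pushforward preimage_bigcup.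
apply: measure_semi_sigma_additive.
- by move=> n; rewrite -[X in measurable X]setTI; exact: measurable_consp.
- apply/trivIsetP => /= i j _ _ ij; rewrite -preimage_setI.
  by move/trivIsetP : tF => /(_ _ _ _ _ ij) ->//; rewrite preimage_set0.
- by rewrite -preimage_bigcup -[X in measurable X]setTI; exact: measurable_consp.
Qed.

HB.instance Definition _ := isMeasure.Build _ _ _ leb_step
  leb_step0 leb_step_ge0 leb_step_sigma_additive.

Lemma leb_stepE (A : set (measurableTypeR R)) (B : set (btuple d)) :
  measurable A -> measurable B ->
  leb_step [set t | A (thead t) /\ B [tuple of behead t]] =
  (lebesgue_measure A * mu B)%E.
Proof.
move=> mA mB; rewrite -product_measure1E//; congr ((lebesgue_measure \x mu)%E _).
apply/seteqP; split => -[x t] /=; rewrite theadE => -[Ax Bt]; split => //=.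
  by rewrite (_ : t = [tuple of behead (x :: t)])//; exact/val_inj.
by rewrite (_ : [tuple of behead (x :: t)] = t)//; exact/val_inj.
Qed.

Lemma measurable_thead : measurable_fun setT (@thead d (measurableTypeR R)).
Proof. exact: (measurable_tnth ord0). Qed.

Let leb_step_sigma_finite : sigma_finite setT leb_step.
Proof.
have /sigma_finiteP[F [TF ndF Foo]] := sigma_finiteT (@lebesgue_measure R).
have /sigma_finiteP[G [TG ndG Goo]] := sigma_finiteT mu.
exists (fun n => [set t | F n (thead t) /\ G n [tuple of behead t]]).
  apply/esym; rewrite -subTset => t _.
  have [n _ Fn] : (\bigcup_i F i) (thead t) by rewrite -TF.
  have [k _ Gk] : (\bigcup_i G i) [tuple of behead t] by rewrite -TG.
  exists (maxn n k) => //; split.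
    by move: Fn; exact/subsetPset/ndF/leq_maxl.
  by move: Gk; exact/subsetPset/ndG/leq_maxr.
move=> k; have [? ?] := Foo k; have [? ?] := Goo k; split.
  apply: measurableI.
    by rewrite -[X in measurable X]setTI; exact: measurable_thead.
  by rewrite -[X in measurable X]setTI; exact: measurable_behead.
by rewrite leb_stepE// lte_mul_pinfty// ge0_fin_numE.
Qed.

HB.instance Definition _ := Measure_isSigmaFinite.Build _ _ _ leb_step
  leb_step_sigma_finite.
End step.

Fixpoint borel_lebesgue d : {sigma_finite_measure set (btuple d) -> \bar R} :=
  if d is d'.+1 then leb_step (borel_lebesgue d') else \d_ [tuple].

Definition box d (a b : 'I_d -> R) : set (btuple d) :=
  [set t | forall i, a i <= tnth t i <= b i].

Lemma measurable_box d (a b : 'I_d -> R) : measurable (box a b).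
Proof.
rewrite (_ : box a b =
    \bigcap_(i in [set: 'I_d]) ((@tnth _ _)^~ i @^-1` `[a i, b i])); last first.
  apply/seteqP; split => t /= H i; first by move=> _ /=; rewrite in_itv/=.
  by have := H i Logic.I; rewrite /= in_itv.
apply: (@fin_bigcap_measurable _ (btuple d)) => [|i _].
  exact: finite_finset.
rewrite -[X in measurable X]setTI.
exact: (@measurable_tnth _ (measurableTypeR R) d i).
Qed.

Lemma borel_lebesgue_box d (a b : 'I_d -> R) : (forall i, a i <= b i) ->
  borel_lebesgue d (box a b) = (\prod_(i < d) (b i - a i))%:E.
Proof.
elim: d a b => [|d IH] a b ab.
  by rewrite big_ord0 /= diracE mem_set// => -[].
have -> : box a b = [set t | `[a ord0, b ord0]%classic (thead t) /\
    box (fun i => a (lift ord0 i)) (fun i => b (lift ord0 i))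
      [tuple of behead t]].
  apply/seteqP; split => t /=.
    move=> H; split; first by rewrite in_itv/=; exact: H.
    by move=> i; have := H (lift ord0 i); rewrite [in X in X -> _](tuple_eta t) tnthS.
  rewrite in_itv/= => -[H0 HS] i.
  have [->|i0] := eqVneq i ord0; first exact: H0.
  case: (unliftP ord0 i) i0 => [j ->|->]; last by rewrite eqxx.
  by move=> _; rewrite [t in tnth t _](tuple_eta t) tnthS; have := HS j.
have bE B : borel_lebesgue d.+1 B = leb_step (borel_lebesgue d) B by [].
rewrite bE leb_stepE//; last exact: measurable_box.
rewrite lebesgue_measure_itv/= lte_fin IH// big_ord_recl EFinM.
case: ltP (ab ord0) => //= ba ab0.
by rewrite (_ : b ord0 = a ord0) ?subrr//; apply/eqP; rewrite eq_le ba ab0.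
Qed.
End borel_lebesgue.


(* R^d with the sigma-algebra of Lebesgue measurable sets; lebesgue is the
   completion of the Borel measure above. *)
Definition euclid (R : realType) (d : nat) :=
  caratheodory_type ((@borel_lebesgue R d)^* )%mu.

Definition lebesgue {R : realType} {d : nat} : set (euclid R d) -> \bar R :=
  @completed_measure_extension _ _ R (@borel_lebesgue R d).

HB.instance Definition _ (R : realType) (d : nat) :=
  Measure.on (@lebesgue R d).

Lemma lebesgue_measurable_box (R : realType) d (a b : 'I_d -> R) :
  measurable (box a b : set (euclid R d)).
Proof.
by apply: sub_caratheodory; apply: sub_sigma_algebra; exact: measurable_box.
Qed.

Lemma lebesgue_box (R : realType) d (a b : 'I_d -> R) :
  (forall i, a i <= b i) ->
  lebesgue (box a b : set (euclid R d)) = (\prod_(i < d) (b i - a i))%:E.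
Proof.
move=> ab; rewrite -borel_lebesgue_box//.
by apply: measurable_mu_extE; exact: measurable_box.
Qed.

Section growth_functions.
Context {R : realType}.
Implicit Types (Phi : R -> R) (q : R).

(* Functions on R_+ are represented by functions R -> R of which only the
   values on [0, +oo[ matter. *)
Definition growth Phi :=
  [/\ forall t, 0 <= t -> 0 <= Phi t,
      exists t, 0 <= t /\ Phi t != 0,
      {within `[0, +oo[, continuous Phi},
      {in `[0, +oo[ &, {homo Phi : s t / s <= t}} &
      forall y, 0 <= y -> exists t, 0 <= t /\ Phi t = y].

Definition upper_type q Phi :=
  exists C : R, 0 < C /\
    forall s t, 0 < s -> 1 <= t -> Phi (s * t) <= C * t `^ q * Phi s.

Definition nondecreasing_pos (f : R -> R) :=
  {in `]0, +oo[ &, {homo f : s t / s <= t}}.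

Definition convex_growth Phi :=
  growth Phi /\ convex_function (`[0, +oo[%classic : set R) Phi.

Definition C1_pos Phi :=
  forall t, 0 < t -> derivable Phi t 1 /\ {for t, continuous (derive1 Phi)}.

Definition derive_approx Phi :=
  exists c : R, 0 < c /\
    forall t, 0 < t ->
      c^-1 * (Phi t / t) <= derive1 Phi t /\ derive1 Phi t <= c * (Phi t / t).

(* The last three conditions are the standing normalization of the elements of
   the class: convex, of class C^1, with derivative comparable to Phi(t)/t. *)
Definition class_Uq q Phi :=
  [/\ growth Phi,
      upper_type q Phi,
      nondecreasing_pos (fun t => Phi t / t) &
      [/\ convex_growth Phi, C1_pos Phi & derive_approx Phi]].

Definition class_U Phi := exists q, 1 <= q /\ class_Uq q Phi.

Definition Delta_prime Phi :=
  exists C : R, 0 < C /\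
    forall s t, 0 < s -> 0 < t -> Phi (s * t) <= C * Phi s * Phi t.

Definition Delta2 Phi :=
  exists K : R, 0 < K /\ forall t, 0 < t -> Phi (2 * t) <= K * Phi t.

Definition nabla2 Phi :=
  [/\ convex_growth Phi, Delta2 Phi &
      exists C : R, 0 < C /\
        forall t, 0 < t ->
          (\int[lebesgue_measure]_(s in `]0%R, t[) (Phi s / s ^+ 2)%:E
             <= (C * (Phi t / t))%:E)%E].

Definition class_Utilde_q q Phi :=
  [/\ class_Uq q Phi, Delta_prime Phi &
      exists C : R, 0 < C /\
        forall s t, 1 <= s -> 1 <= t -> Phi (s / t) <= C * Phi s / t `^ q].

Definition class_Utilde Phi := exists q, 1 <= q /\ class_Utilde_q q Phi.

(* Inverse of a bijection of R_+. *)
Definition ginv Phi : R -> R := pinv_ (fun=> 0) `[0, +oo[ Phi.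

End growth_functions.

Section weights.
Context {R : realType} {d : nat}.
Local Notation euclid := (euclid R d).
Local Open Scope ereal_scope.

Definition cube (a : 'I_d -> R) (l : R) : set euclid :=
  box a (fun i => a i + l)%R.

Definition cubes : set (set euclid) :=
  [set Q | exists (a : 'I_d -> R) (l : R), (0 < l)%R /\ Q = cube a l].

(* Every compact set lies in a cube, so integrability on the cubes is local
   integrability. *)
Definition weight (sigma : euclid -> R) :=
  (forall Q, cubes Q -> lebesgue.-integrable Q (EFin \o sigma)) /\
  {ae lebesgue, forall x, (0 < sigma x)%R}.

Definition wmeas (sigma : euclid -> R) (E : set euclid) : \bar R :=
  \int[lebesgue]_(x in E) (sigma x)%:E.

Definition doubling (sigma : euclid -> R) :=
  exists C : R, (1 < C)%R /\
    forall (a a' : 'I_d -> R) (l l' : R), (0 < l)%R -> (0 < l')%R ->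
      cube a l `<=` cube a' l' -> (l' <= 2 * l)%R ->
      wmeas sigma (cube a' l') <= C%:E * wmeas sigma (cube a l).

Definition modulus (f : euclid -> R[i]) : euclid -> \bar R :=
  fun x => (Normc.normc (f x))%:E.

Definition measurableC (f : euclid -> R[i]) :=
  measurable_fun setT (fun x => complex.Re (f x)) /\
  measurable_fun setT (fun x => complex.Im (f x)).

(* Luxemburg functional; g may take the value +oo, where Phi is +oo. *)
Definition luxemburg (Phi : R -> R) (sigma : euclid -> R) (g : euclid -> \bar R)
    : \bar R :=
  ereal_inf [set lam%:E | lam in [set lam : R | (0 < lam)%R /\
    \int[lebesgue]_x (er_map Phi (`|g x| / lam%:E) * (sigma x)%:E) <= 1]].

Definition in_Orlicz Phi sigma (f : euclid -> R[i]) :=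
  measurableC f /\ luxemburg Phi sigma (modulus f) < +oo.

Definition maximal n (sigma : 'I_n -> euclid -> R) (f : 'I_n -> euclid -> R[i])
    (x : euclid) : \bar R :=
  ereal_sup [set \prod_(i < n)
      ((\1_Q x)%:E / wmeas (sigma i) Q *
       \int[lebesgue]_(y in Q) (modulus (f i) y * (sigma i y)%:E)) |
    Q in cubes].

Section operators.
Context n (T : ('I_n -> euclid -> R[i]) -> euclid -> \bar R).
Context (Phi : 'I_n -> R -> R) (sigma : 'I_n -> euclid -> R).
Context (Psi : R -> R) (omega : euclid -> R).

Definition bounded_by (C : R) :=
  forall f : 'I_n -> euclid -> R[i],
    (forall j, in_Orlicz (Phi j) (sigma j) (f j)) ->
    luxemburg Psi omega (T f) <=
      C%:E * \prod_(j < n) luxemburg (Phi j) (sigma j) (modulus (f j)).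

Definition bounded_operator := exists C : R, (0 < C)%R /\ bounded_by C.

Definition operator_norm : \bar R :=
  ereal_inf [set C%:E | C in [set C : R | (0 < C)%R /\ bounded_by C]].

End operators.

Definition K_constant n (Phi : 'I_n -> R -> R) (Psi : R -> R)
    (sigma : 'I_n -> euclid -> R) (omega : euclid -> R) : \bar R :=
  ereal_sup [set wmeas omega Q *
      \prod_(i < n) er_map (Psi \o ginv (Phi i)) (wmeas (sigma i) Q)^-1 |
    Q in cubes].

End weights.

(* Main.v *)
Require Import Defs.
From mathcomp Require Import all_boot all_order all_algebra.
From mathcomp Require Import all_classical all_reals all_analysis.
From mathcomp Require Import measurable_realfun complex ring lra.

Set Implicit Arguments.
Unset Strict Implicit.
Unset Printing Implicit Defensive.
Import Order.TTheory GRing.Theory Num.Theory.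
Import numFieldNormedType.Exports.
Local Open Scope classical_set_scope.
Local Open Scope ring_scope.

(** The hypotheses on Psi make it behave like a power: up to constants,
    Psi(s t) is Psi(s) Psi(t) (class_Utilde_quasi_mult).

    Necessity is seen by testing on f_i = a_i 1_Q with
    a_i = Phi_i^-1(1 / sigma_i(Q)), functions of norm at most 1 whose maximal
    function is at least a_1 ... a_n on Q.  If the operator is bounded by C,
    then omega(Q) Psi(a_1 ... a_n / 2C) <= 1, and quasi-multiplicativity turns
    this into omega(Q) Psi(a_1) ... Psi(a_n) <= c Psi(2C) (necessity).

    Sufficiency splits according to n.  If n >= 2, the constant is infinite for
    every weight omega (K_constant_infinite), so that by necessity no bound
    exists and both sides of the norm estimate are infinite.  Indeed, the
    monotonicity of Psi / Phi_i bounds Psi(a_i) from below by a multiple of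
    1 / sigma_i(Q) on small cubes; a finite constant would thus give
    omega(Q) <= kappa sigma_1(Q) sigma_2(Q), and a fine covering of the unit
    cube would show that omega vanishes there.

    If n = 1, suppose that Phi(g) sigma has integral at most 1 and that the
    averages of g over some cubes exceed 2t.  Vitali's covering lemma selects
    disjoint cubes Q among these whose triples cover them all.  On each of
    them t sigma(Q) is at most the integral over Q of g 1_{g > t} sigma, which
    Chebyshev's inequality bounds by t / Phi(t); so t <= Phi^-1(1 / sigma(Q)),
    and the monotonicity of Psi / Phi together with the bound K on the constant,
    applied to the triple of Q, yields
      Psi(t) omega(3Q) <= c K Phi(t) / t * (integral over Q of g 1_{g > t} sigma)
    (cube_level).  Summation over the selected cubes and then over t = t0 2^i
    bounds the integral of Psi(M g) omega by c K, because the hypothesis nabla2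
    sums Phi(t_i) / t_i over the levels t_i < g(x) to a multiple of
    Phi(g(x)) / g(x) (nabla2_lacunary_sum, integral_finite_max).  This is done
    for finitely many cubes with rational data; doubling passes from these to
    all cubes and monotone convergence to the full supremum
    (integral_maximal1). *)

(** * Growth functions *)

Section growth.
Context {R : realType}.
Implicit Types Phi Psi : R -> R.

(** The fourth property is the monotonicity of Phi(t) / t, in a form that
    covers t = 0. *)
Definition young Phi :=
  [/\ Phi 0 = 0,
      {in `[0, +oo[ &, {homo Phi : s t / s <= t}},
      (forall t, 0 < t -> 0 < Phi t),
      (forall c t, 1 <= c -> 0 <= t -> c * Phi t <= Phi (c * t)) &
      (forall y, 0 <= y -> 0 <= ginv Phi y /\ Phi (ginv Phi y) = y)].

(** Upper type forces Phi to be positive off 0, for a zero at t > 0 would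
    propagate to all s >= t. *)
Lemma class_U_young Phi : class_U Phi -> young Phi.
Proof.
move=> [q [q1 [[pos [t0 [t0ge0 Pt0]] _ ndPhi onto] [C [C0 ut]] star _]]].
have Phi0 : Phi 0 = 0.
  have [t [t0' Pt]] := onto 0 (lexx _).
  apply/eqP; rewrite eq_le pos// andbT.
  have : Phi 0 <= Phi t by apply: ndPhi => //; rewrite in_itv/= ?lexx ?t0'.
  by rewrite Pt.
have t0gt0 : 0 < t0.
  by rewrite lt_neqAle t0ge0 andbT eq_sym; apply: contraNneq Pt0 => ->; apply/eqP.
have Pgt0 t : 0 < t -> 0 < Phi t.
  move=> tgt0; rewrite lt_neqAle pos ?(ltW tgt0)// andbT eq_sym.
  apply/eqP => Pt; move/eqP: Pt0; apply; apply/eqP.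
  rewrite eq_le pos// andbT.
  have [t0t|tt0] := leP t0 t.
    have : Phi t0 <= Phi t.
      by apply: ndPhi => //; rewrite in_itv/= ?t0ge0 ?(ltW tgt0).
    by rewrite Pt.
  have := ut t (t0 / t) tgt0; rewrite Pt mulr0 mulrCA divff ?gt_eqF// mulr1.
  by apply; rewrite ler_pdivlMr// mul1r ltW.
split => //.
  move=> c t c1; rewrite le_eqVlt => /predU1P[<-|tgt0]; first by rewrite !mulr0 Phi0 mulr0.
  have c0 : 0 < c by exact: lt_le_trans c1.
  have := star t (c * t); rewrite !in_itv/= !andbT tgt0 mulr_gt0//.
  move=> /(_ isT isT); rewrite ler_peMl ?(ltW tgt0)// => /(_ isT).
  have -> : c * Phi t = Phi t / t * (c * t) by field; rewrite gt_eqF.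
  by rewrite ler_pdivlMr ?mulr_gt0.
move=> y y0.
have Psurj : set_surj `[0, +oo[%classic `[0, +oo[%classic Phi.
  move=> z /=; rewrite in_itv/= andbT => /onto[t [? <-]].
  by exists t => //=; rewrite in_itv/= andbT.
split.
  have : `[0, +oo[%classic (ginv Phi y).
    by apply: (surjpinv_image_sub Psurj); exists y => //=; rewrite in_itv/= y0.
  by rewrite /= in_itv/= andbT.
by rewrite /ginv (surjpK _ Psurj)// inE/= in_itv/= y0.
Qed.

Section young.
Context Phi (yPhi : young Phi).

Lemma young0 : Phi 0 = 0. Proof. by case: yPhi. Qed.

Lemma young_gt0 t : 0 < t -> 0 < Phi t. Proof. by case: yPhi => _ _ + _ _; exact. Qed.

Lemma young_le s t : 0 <= s -> s <= t -> Phi s <= Phi t.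
Proof.
case: yPhi => _ + _ _ _ => nd s0 st.
by apply: nd => //; rewrite in_itv/= andbT// (le_trans s0).
Qed.

Lemma young_ge0 t : 0 <= t -> 0 <= Phi t.
Proof. by move=> t0; rewrite -young0 young_le. Qed.

Lemma young_star c t : 1 <= c -> 0 <= t -> c * Phi t <= Phi (c * t).
Proof. by case: yPhi => _ _ _ + _; exact. Qed.

Lemma young_lt s t : 0 <= s -> s < t -> Phi s < Phi t.
Proof.
rewrite le_eqVlt => /predU1P[<-|s0] st; first by rewrite young0 young_gt0.
have := @young_star (t / s) s; rewrite ler_pdivlMr// mul1r (ltW st) (ltW s0).
rewrite divfK ?gt_eqF// => /(_ isT isT); apply: lt_le_trans.
by rewrite ltr_pMl ?young_gt0// ltr_pdivlMr// mul1r.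
Qed.

Lemma young_le_inv s t : 0 <= t -> Phi s <= Phi t -> s <= t.
Proof. by move=> t0; apply: contraTT; rewrite -!ltNge; exact: young_lt. Qed.

Lemma ginv_ge0 y : 0 <= y -> 0 <= ginv Phi y.
Proof. by case: yPhi => _ _ _ _ h /h[]. Qed.

Lemma ginvK y : 0 <= y -> Phi (ginv Phi y) = y.
Proof. by case: yPhi => _ _ _ _ h /h[]. Qed.

Lemma ginv_gt0 y : 0 < y -> 0 < ginv Phi y.
Proof.
move=> y0; rewrite lt_neqAle ginv_ge0 ?(ltW y0)// andbT.
by apply/eqP => e; move: (y0); rewrite -(ginvK (ltW y0)) -e young0 ltxx.
Qed.

Lemma ginv_le y z : 0 <= z -> y <= Phi z -> 0 <= y -> ginv Phi y <= z.
Proof. by move=> z0 yz y0; apply: young_le_inv => //; rewrite ginvK. Qed.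

Lemma le_ginv y z : Phi z <= y -> 0 <= y -> z <= ginv Phi y.
Proof. by move=> zy y0; apply: young_le_inv; [exact: ginv_ge0|rewrite ginvK]. Qed.

Lemma young_slope s t : 0 < s -> s <= t -> Phi s / s <= Phi t / t.
Proof.
move=> s0 st; have t0 : 0 < t by exact: lt_le_trans st.
have := @young_star (t / s) s; rewrite ler_pdivlMr// mul1r st (ltW s0).
rewrite divfK ?gt_eqF// => /(_ isT isT) h.
by rewrite ler_pdivlMr// mulrAC -mulrA (mulrC (Phi s)).
Qed.

Lemma young_measurable d (T : measurableType d) (g : T -> R) :
  (forall x, 0 <= g x) -> measurable_fun setT g ->
  measurable_fun setT (fun x => Phi (g x)).
Proof.
move=> g0 mg.
have -> : (fun x => Phi (g x)) = (fun t => Phi (Num.max t 0)) \o g.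
  by apply/funext => x /=; rewrite max_l.
apply: measurableT_comp => //.
apply: nondecreasing_measurable => // s t st.
apply: young_le; first by rewrite le_max lexx orbT.
by rewrite ge_max !le_max st lexx !orbT.
Qed.

End young.


Definition quasi_mult (B : R) Psi := forall s t, 0 < s -> 0 < t ->
  Psi (s * t) <= B * (Psi s * Psi t) /\ Psi s * Psi t <= B * Psi (s * t).

(** The upper bound is the condition Delta'.  It also gives
    Psi(s) <= C Psi(st) Psi(1/t), so that the lower bound only requires
    Psi(t) Psi(1/t) to be bounded: for t >= 1 the upper type contributes t^q
    and the decay of Psi(s/t) contributes t^-q. *)
Lemma class_Utilde_quasi_mult Psi : class_Utilde Psi ->
  young Psi /\ exists B, 0 < B /\ quasi_mult B Psi.
Proof.
move=> [q [q1 [Uq [C [C0 sub]] [D [D0 low]]]]].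
have [_ [E [E0 up]] _ _] := Uq.
have yPsi : young Psi by apply: class_U_young; exists q.
split=> //.
have P1 := young_gt0 yPsi ltr01.
have large t : 1 <= t -> Psi t * Psi t^-1 <= D * E * Psi 1 ^+ 2.
  move=> t1; have t0 : 0 < t by exact: lt_le_trans t1.
  have tq0 : 0 < t `^ q by rewrite powR_gt0.
  have := low 1 t (lexx _) t1; rewrite div1r => lowt.
  have := up 1 t ltr01 t1; rewrite mul1r => upt.
  apply: (@le_trans _ _ ((E * t `^ q * Psi 1) * (D * Psi 1 / t `^ q))).
    by apply: ler_pM => //; rewrite ltW// young_gt0// invr_gt0.
  rewrite le_eqVlt; apply/orP; left; apply/eqP; field.
  by rewrite gt_eqF.
have inv t : 0 < t -> Psi t * Psi t^-1 <= D * E * Psi 1 ^+ 2.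
  move=> t0; have [/large//|t1] := leP 1 t.
  have := large t^-1; rewrite invrK mulrC; apply.
  by rewrite invf_ge1// ltW.
pose M := D * E * Psi 1 ^+ 2.
have M0 : 0 < M by rewrite !mulr_gt0// exprn_gt0.
exists (C * (1 + M)); split; first by rewrite mulr_gt0// addr_gt0.
move=> s t s0 t0; have Ps := young_gt0 yPsi s0; have Pt := young_gt0 yPsi t0.
have Pst : 0 < Psi (s * t) by rewrite young_gt0// mulr_gt0.
split.
  apply: (le_trans (sub _ _ s0 t0)).
  by rewrite mulrDr mulr1 mulrDl mulrA lerDl !mulr_ge0// ltW.
have := sub (s * t) t^-1; rewrite mulfK ?gt_eqF// invr_gt0 mulr_gt0//.
move=> /(_ isT t0) h.
apply: (@le_trans _ _ ((C * Psi (s * t) * Psi t^-1) * Psi t)).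
  by rewrite ler_wpM2r// ltW.
rewrite -[_ * Psi t^-1 * _]mulrA (mulrC (Psi t^-1)).
apply: (@le_trans _ _ (C * Psi (s * t) * M)).
  by rewrite ler_wpM2l ?inv// mulr_ge0// ltW.
by rewrite mulrAC ler_wpM2r ?(ltW Pst)// ler_wpM2l ?lerDr// ltW.
Qed.

Section quasi_mult.
Context Psi B (yPsi : young Psi) (B0 : 0 < B) (qm : quasi_mult B Psi).

Lemma quasi_mult_upper s t : 0 <= s -> 0 <= t ->
  Psi (s * t) <= B * (Psi s * Psi t).
Proof.
rewrite le_eqVlt => /predU1P[<-|s0]; first by rewrite mul0r young0// mul0r mulr0.
rewrite le_eqVlt => /predU1P[<-|t0]; first by rewrite mulr0 young0// !mulr0.
by have [] := qm s0 t0.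
Qed.

Lemma quasi_mult_div s t : 0 <= s -> 0 < t ->
  Psi (s / t) <= B * Psi s / Psi t.
Proof.
rewrite le_eqVlt => /predU1P[<-|s0] t0; first by rewrite mul0r young0// mulr0 mul0r.
rewrite ler_pdivlMr ?young_gt0//.
have [_] := @qm (s / t) t (divr_gt0 s0 t0) t0.
by rewrite divfK ?gt_eqF.
Qed.

Lemma quasi_mult_prod n (a : 'I_n -> R) : (forall i, 0 < a i) ->
  Psi 1 * \prod_(i < n) Psi (a i) <= B ^+ n * Psi (\prod_(i < n) a i).
Proof.
elim: n a => [|n IH] a a0; first by rewrite !big_ord0 expr0 mulr1 mul1r.
have p0 : 0 < \prod_(i < n) a (widen_ord (leqnSn n) i) by exact: prodr_gt0.
rewrite !big_ord_recr/= mulrA.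
have P0 := young_gt0 yPsi (a0 ord_max).
apply: (le_trans (ler_wpM2r (ltW P0) (IH _ _))) => //.
rewrite exprSr -!mulrA ler_wpM2l ?exprn_ge0 ?(ltW B0)//.
by have [] := qm p0 (a0 ord_max).
Qed.

End quasi_mult.

End growth.

(** * Integrals against a weight *)

Section integral_facts.
Context d (T : measurableType d) (R : realType) (mu : {measure set T -> \bar R}).
Local Open Scope ereal_scope.

(** The integral of any nonnegative function is a supremum over simple
    functions, hence monotone; this serves the maximal function, a supremum
    over an uncountable family. *)
Lemma ge0_le_integral_any (D : set T) (f g : T -> \bar R) :
  (forall x, D x -> 0 <= f x) -> (forall x, D x -> f x <= g x) ->
  \int[mu]_(x in D) f x <= \int[mu]_(x in D) g x.
Proof.
move=> f0 fg.
have g0 x : D x -> 0 <= g x by move=> Dx; exact: le_trans (f0 _ Dx) (fg _ Dx).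
rewrite !ge0_integralE//; apply: ereal_sup_le => _ [h hf <-].
exists h => //= x; apply: (le_trans (hf x)); rewrite !patchE.
by case: ifPn => // /set_mem /fg.
Qed.

(** The negative part of F w lives on a null set, so its integral is at most
    that of an infinite constant on this set, which is 0. *)
Lemma integral_mul_pos_part (D : set T) (F : T -> \bar R) (w : T -> R) :
  measurable D -> (forall x, 0 <= F x) -> {ae mu, forall x, (0 < w x)%R} ->
  \int[mu]_(x in D) (F x * (w x)%:E) =
  \int[mu]_(x in D) (F x * (Num.max (w x) 0)%:E).
Proof.
move=> mD F0 [N [mN N0 wN]].
have pE x : maxe (F x * (w x)%:E) 0 = F x * (Num.max (w x) 0)%:E.
  case: (leP 0%R (w x)) => w0.
    by rewrite max_l// mule_ge0.
  by rewrite mule0 max_r// mule_ge0_le0// lee_fin ltW.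
rewrite integralE.
have -> : \int[mu]_(x in D) (fun x => F x * (w x)%:E)^\- x = 0.
  apply/eqP; rewrite eq_le integral_ge0 ?andbT; last first.
    by move=> x _; rewrite funenegE le_max lexx orbT.
  apply: (@le_trans _ _ (\int[mu]_(x in D) ((cst +oo) \_ N) x)).
    apply: ge0_le_integral_any => x Dx.
      by rewrite funenegE le_max lexx orbT.
    rewrite patchE; case: ifPn => [_|/negP xN]; first exact: leey.
    have w0 : (0 < w x)%R.
      by apply: contrapT => /wN Nx; apply: xN; rewrite inE.
    by rewrite funenegE ge_max lexx andbT oppe_le0 mule_ge0// lee_fin ltW.
  rewrite -integral_mkcondr.
  have : \int[mu]_(x in D `&` N) `|cst +oo x : \bar R| = 0.
    apply: integral_abs_eq0 => //; first exact: measurableI.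
    by apply: subset_measure0 N0 => //; exact: measurableI.
  by move=> <-.
rewrite sube0; apply: eq_integral => x _.
by rewrite funeposE pE.
Qed.

End integral_facts.

(** * Lacunary sums and the condition nabla2 *)

Section nabla2.
Context {R : realType}.

(** With t_i = t0 2^i, the function Phi(s) / s^2 is at least
    Phi(t_i) / (t_i t_{i+1}) on [t_i, t_{i+1}[, an interval of length t_i, so
    the nabla2 integral up to t_m dominates half the sum of the terms below
    t_m.  When t_m is the last level below u, its own term is at most
    Phi(u) / u. *)
Lemma nabla2_lacunary_sum (Phi : R -> R) : young Phi -> nabla2 Phi ->
  exists D, 0 < D /\ forall t0 m u, 0 < t0 -> 0 <= u ->
    \sum_(i < m | t0 * 2 ^+ i < u) Phi (t0 * 2 ^+ i) / (t0 * 2 ^+ i) * u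
      <= D * Phi u.
Proof.
move=> yPhi [_ _ [C [C0 intC]]].
pose phi t := Phi t / t.
have phi_ge0 t : 0 < t -> 0 <= phi t.
  by move=> t0; rewrite /phi divr_ge0 ?young_ge0// ltW.
have tgt0 (t0 : R) i : 0 < t0 -> 0 < t0 * 2 ^+ i.
  by move=> ?; rewrite mulr_gt0// exprn_gt0.
have full t0 m : 0 < t0 ->
    \sum_(i < m) phi (t0 * 2 ^+ i) <= 2 * C * phi (t0 * 2 ^+ m).
  move=> t00; set t := t0 * 2 ^+ m.
  pose I i := `[t0 * 2 ^+ i, t0 * 2 ^+ i.+1[%classic : set R.
  have step : ((\sum_(i < m) phi (t0 * 2 ^+ i) / 2)%:E <=
      \int[lebesgue_measure]_(s in `]0%R, t[) (Phi s / s ^+ 2)%:E)%E.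
    have coef_ge0 i : 0 <= phi (t0 * 2 ^+ i) / (t0 * 2 ^+ i.+1).
      by rewrite mulr_ge0 ?invr_ge0 ?(ltW (tgt0 _ _ _))// phi_ge0// tgt0.
    have mI i : measurable (I i) by exact: measurable_itv.
    apply: (@le_trans _ _ (\int[lebesgue_measure]_(s in `]0%R, t[)
        \sum_(i < m) (phi (t0 * 2 ^+ i) / (t0 * 2 ^+ i.+1) * \1_(I i) s)%:E)%E).
      rewrite ge0_integral_sum//; last 2 first.
      - move=> i; apply/measurable_EFinP; apply: measurable_funM => //.
        by apply: measurable_indic; exact: measurable_itv.
      - move=> i s _; rewrite lee_fin mulr_ge0 ?coef_ge0//. 
      rewrite -sumEFin.
      rewrite lee_sum// => i _.
      under eq_integral do rewrite EFinM.
      rewrite ge0_integralZl_EFin//=; last first.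
        by apply/measurable_EFinP; apply: measurable_indic; exact: measurable_itv.
      rewrite integral_indic//; [|exact: measurable_itv..].
      rewrite setIidl; last first.
        move=> s /=; rewrite !in_itv/= => /andP[ts st].
        rewrite (lt_le_trans (tgt0 _ _ t00) ts) (lt_le_trans st)//.
        by rewrite ler_pM2l// ler_eXn2l ?ltr1n.
      rewrite [X in (_ <= _ * X)%E](lebesgue_measure_itv `[t0 * 2 ^+ i, t0 * 2 ^+ i.+1[)/=.
      rewrite lte_fin ltr_pM2l// ltr_eXn2l ?ltr1n// ltnSn.
      rewrite -EFinB -EFinM lee_fin exprS.
      rewrite le_eqVlt; apply/orP; left; apply/eqP; field.
      by rewrite expf_neq0//= gt_eqF.
    apply: ge0_le_integral_any => s /=; rewrite in_itv/= => /andP[s0 st].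
      rewrite sume_ge0// => i _; rewrite lee_fin.
      by apply: mulr_ge0; rewrite ?coef_ge0.
    rewrite sumEFin lee_fin.
    elim: (m) => [|k IH].
      by rewrite big_ord0 divr_ge0 ?exprn_ge0 ?(ltW s0)// young_ge0// ltW.
    rewrite big_ord_recr/=.
    have [Iks|Iks] := boolP (s \in I k); last first.
      by rewrite indicE (negbTE Iks) mulr0 addr0.
    rewrite big1 ?add0r => [|i _]; last first.
      rewrite indicE memNset ?mulr0// /I /= in_itv/= => /andP[_].
      apply/negP; rewrite -leNgt; move: Iks; rewrite inE /I /= in_itv/=.
      by case/andP => ts _; apply: le_trans ts; rewrite ler_pM2l// ler_eXn2l ?ltr1n.
    rewrite indicE Iks mulr1; move: Iks; rewrite inE /I /= in_itv/= => /andP[ts st'].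
    have -> : Phi s / s ^+ 2 = (Phi s / s) * s^-1 by rewrite expr2 invfM mulrA.
    apply: ler_pM; [exact/phi_ge0/tgt0|by rewrite invr_ge0 ltW ?tgt0| |].
      by apply: (young_slope yPhi) => //; exact: tgt0.
    by rewrite lef_pV2 ?posrE ?tgt0// ltW.
  have := le_trans step (intC _ (tgt0 _ _ t00)).
  rewrite lee_fin -mulr_suml ler_pdivrMr// => /le_trans; apply.
  by rewrite mulrAC (mulrC C).
exists (1 + 2 * C); split; first by lra.
move=> t0 m u t00; rewrite le_eqVlt => /predU1P[<-|u0].
  by rewrite young0// mulr0 big1// => i _; rewrite mulr0.
rewrite -mulr_suml -ler_pdivlMr// -mulrA.
elim: m => [|m IH]; first by rewrite big_ord0 mulr_ge0 ?phi_ge0//; lra.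
have [tu|ut] := ltP (t0 * 2 ^+ m) u; last first.
  rewrite big_mkcond big_ord_recr/= ltNge ut/= addr0.
  by rewrite -big_mkcond; exact: IH.
rewrite big_mkcond big_ord_recr/= tu -big_mkcond/=.
apply: (@le_trans _ _ ((1 + 2 * C) * phi (t0 * 2 ^+ m))).
  rewrite mulrDl mul1r addrC lerD2l; apply: le_trans (full _ _ t00).
  rewrite big_mkcond ler_sum// => i _; case: ifP => // _; exact: phi_ge0 (tgt0 _ _ t00).
rewrite ler_wpM2l//; first lra.
by apply: (young_slope yPhi) => //; [exact: tgt0|exact: ltW].
Qed.
End nabla2.

(** * Cubes and masses *)

Section disjoint_and_covering.
Context d (T : measurableType d) (R : realType) (mu : {measure set T -> \bar R}).
Context (I : finType) (F : I -> set T) (S : {set I}) (f : T -> \bar R).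
Hypothesis mF : forall i, measurable (F i).
Hypothesis f0 : forall x, (0 <= f x)%E.
Hypothesis mf : measurable_fun setT f.
Local Open Scope ereal_scope.

Lemma le_sum_integral_disjoint (D : set T) : measurable D ->
  {in S, forall i, F i `<=` D} ->
  {in S &, forall i j, i != j -> F i `&` F j = set0} ->
  \sum_(i in S) \int[mu]_(x in F i) f x <= \int[mu]_(x in D) f x.
Proof.
move=> mD FD disj; rewrite -big_enum/= -ge0_integral_bigsetU//.
- apply: ge0_subset_integral => //.
  + by apply: bigsetU_measurable => i _; exact: mF.
  + exact: measurable_funTS.
  + rewrite -bigcup_seq => x [i /=]; rewrite mem_enum => iS; exact: FD.
- exact: enum_uniq.
- move=> i j /=; rewrite !mem_enum => iS jS [x Fx].
  by apply: contrapT => /eqP ij; move: Fx; rewrite disj.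
- exact: measurable_funTS.
Qed.

Lemma integral_le_sum_cover (E : set T) :
  (forall x, E x -> exists2 i, i \in S & F i x) ->
  \int[mu]_(x in E) f x <= \sum_(i in S) \int[mu]_(x in F i) f x.
Proof.
move=> cov.
have -> : \sum_(i in S) \int[mu]_(x in F i) f x =
    \int[mu]_x \sum_(i <- enum S) (f \_ (F i)) x.
  rewrite ge0_integral_sum//.
  - rewrite -big_enum/=; apply: eq_bigr => i _; exact: integral_mkcond.
  - by move=> i; apply/(measurable_restrictT f (mF i)); exact: measurable_funTS.
  - by move=> i x _; rewrite erestrict_ge0.
rewrite integral_mkcond; apply: ge0_le_integral_any => x _.
  by rewrite erestrict_ge0.
rewrite patchE; case: ifPn => [/set_mem Ex|_]; last first.
  by apply: sume_ge0 => i _; rewrite erestrict_ge0.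
have [i iS Fix] := cov _ Ex.
rewrite (bigD1_seq i) ?mem_enum ?enum_uniq//= patchE mem_set//.
rewrite leeDl//; apply: sume_ge0 => j _; rewrite erestrict_ge0//.
Qed.

End disjoint_and_covering.

Section cubes.
Context {R : realType} {d : nat}.
Implicit Types (a : 'I_d -> R) (l : R) (sigma omega : euclid R d -> R).

Lemma measurable_cube a l : measurable (cube a l).
Proof. exact: lebesgue_measurable_box. Qed.

Lemma subset_cube a l a' l' :
  (forall i, a' i <= a i) -> (forall i, a i + l <= a' i + l') ->
  cube a l `<=` cube a' l'.
Proof.
move=> lo hi x /= Qx i; have /andP[ax xa] := Qx i.
by rewrite (le_trans (lo i) ax) (le_trans xa (hi i)).
Qed.

Lemma cube_nonempty a l : 0 <= l -> cube a l !=set0.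
Proof.
move=> l0; exists [tuple a i | i < d] => i /=.
by rewrite tnth_mktuple lexx lerDl.
Qed.

Definition triple a l : set (euclid R d) := cube (fun i => a i - l) (3 * l).

Lemma meet_subset_triple a l a' l' : l <= l' ->
  cube a l `&` cube a' l' !=set0 -> cube a l `<=` triple a' l'.
Proof.
move=> ll' [x [Qx Qx']]; apply: subset_cube => i;
  have := Qx i; have := Qx' i; lra.
Qed.

(** A cube of maximal side is kept; the cubes that meet it lie in its triple,
    and the selection goes on among those that miss it. *)
Lemma vitali_cubes (I : finType) (a : I -> 'I_d -> R) (l : I -> R) (A : {set I}) :
  (forall i, 0 < l i) ->
  exists S : {set I}, [/\ S \subset A,
    {in S &, forall i j, i != j -> cube (a i) (l i) `&` cube (a j) (l j) = set0} &
    forall i, i \in A -> exists2 j, j \in S &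
      cube (a i) (l i) `<=` triple (a j) (l j)].
Proof.
move=> l0; have [m] := ubnP #|A|; elim: m => // m IH in A *; rewrite ltnS => Am.
have [->|[i0 i0A]] := set_0Vmem A.
  by exists finset.set0; split => [||i]; rewrite ?sub0set ?inE //; by move=> i; rewrite inE.
have [j jA jmax] := arg_maxP l i0A.
have {}jA : j \in A by [].
pose A' := [set i in A | `[< cube (a i) (l i) `&` cube (a j) (l j) = set0 >]]%SET.
have jA' : j \notin A'.
  rewrite inE jA/=; apply/asboolPn; rewrite setIid.
  by apply/eqP/set0P/cube_nonempty/ltW.
have [|S [SA' disj cov]] := IH A'.
  apply: leq_trans Am; apply: proper_card; apply/properP; split.
    by apply/fintype.subsetP => i; rewrite inE => /andP[].
  by exists j.
have S' i : i \in S -> cube (a i) (l i) `&` cube (a j) (l j) = set0.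
  by move=> /(fintype.subsetP SA'); rewrite inE => /andP[_ /asboolP].
exists (j |: S)%SET; split.
- apply/fintype.subsetP => i /setU1P[->//|/(fintype.subsetP SA')].
  by rewrite inE => /andP[].
- move=> i k /setU1P[->|iS] /setU1P[->|kS]; rewrite ?eqxx//.
  + by move=> _; rewrite setIC S'.
  + by move=> _; rewrite S'.
  + exact: disj.
move=> i iA; have [iA'|] := boolP (i \in A').
  by have [k kS ik] := cov _ iA'; exists k => //; rewrite in_setU1 kS orbT.
rewrite inE iA/= => /asboolPn/eqP/set0P meet.
exists j; first by rewrite in_setU1 eqxx.
by apply: meet_subset_triple meet; exact: jmax.
Qed.

(** A weight that is nonnegative at every point, so that its integrals are
    monotone without exceptional sets. *)
Definition nweight sigma :=
  [/\ forall x, 0 <= sigma x, measurable_fun setT sigma &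
      forall a l, 0 < l -> (0 < wmeas sigma (cube a l) < +oo)%E].

Definition mass sigma a l : R := fine (wmeas sigma (cube a l)).

Section mass.
Context sigma (w : nweight sigma).

Lemma massE a l : 0 < l -> wmeas sigma (cube a l) = (mass sigma a l)%:E.
Proof.
by case: w => _ _ h l0; have /andP[p0 poo] := h a l l0; rewrite fineK// ge0_fin_numE// ltW.
Qed.

Lemma mass_gt0 a l : 0 < l -> 0 < mass sigma a l.
Proof.
by case: w => _ _ h l0; have /andP[p0 poo] := h a l l0; rewrite -lte_fin -massE.
Qed.

Lemma le_wmeas A B : measurable A -> measurable B -> A `<=` B ->
  (wmeas sigma A <= wmeas sigma B)%E.
Proof.
case: w => s0 ms _ mA mB AB; apply: ge0_subset_integral; [exact: mA|exact: mB| | |exact: AB].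
  by apply/measurable_EFinP; exact: measurable_funTS.
by move=> x _; rewrite lee_fin.
Qed.

Lemma mass_le a l a' l' : 0 < l -> 0 < l' -> cube a l `<=` cube a' l' ->
  mass sigma a l <= mass sigma a' l'.
Proof.
move=> l0 l0' sub; rewrite -lee_fin -!massE//.
by apply: le_wmeas => //; exact: measurable_cube.
Qed.

Lemma integral_cube_scale k a l : 0 <= k -> 0 < l ->
  (\int[lebesgue]_(y in cube a l) (k%:E * (sigma y)%:E) = (k * mass sigma a l)%:E)%E.
Proof.
move=> k0 l0; have [s0 ms _] := w; rewrite EFinM -massE//.
apply: ge0_integralZl_EFin k0; first exact: measurable_cube.
  by move=> x _; rewrite lee_fin.
by apply/measurable_EFinP; exact: measurable_funTS.
Qed.

Lemma mass_doubling : doubling sigma -> exists2 C, 1 < C &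
  forall a l a' l', 0 < l -> 0 < l' -> cube a l `<=` cube a' l' -> l' <= 2 * l ->
  mass sigma a' l' <= C * mass sigma a l.
Proof.
move=> [C [C1 dbl]]; exists C => // a l a' l' l0 l0' sub ll'.
by rewrite -lee_fin EFinM -!massE//; exact: dbl.
Qed.

End mass.

(** Tripling the side takes two doublings; the same constant is kept for a
    single doubling. *)
Lemma mass_triple sigma : nweight sigma -> doubling sigma -> exists2 C, 1 < C &
  (forall a l a' l', 0 < l -> 0 < l' -> cube a l `<=` cube a' l' -> l' <= 2 * l ->
    mass sigma a' l' <= C * mass sigma a l) /\
  (forall a l, 0 < l ->
    mass sigma (fun i => a i - l) (3 * l) <= C * mass sigma a l).
Proof.
move=> w /(mass_doubling w)[C C1 dbl]; exists (C * C); first by rewrite -[1]mul1r ltr_pM.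
have C0 : 0 < C by exact: lt_trans C1.
split.
  move=> a l a' l' l0 l0' sub ll'; apply: (le_trans (dbl _ _ _ _ l0 l0' sub ll')).
  by rewrite ler_wpM2r ?(ltW (mass_gt0 w _ _))// ler_pMl// ltW.
move=> a l l0; rewrite -mulrA.
apply: (@le_trans _ _ (C * mass sigma (fun i => a i - l) (2 * l))).
  by apply: dbl; rewrite ?mulr_gt0//; [apply: subset_cube => i; lra|lra].
rewrite ler_pM2l//; apply: dbl; rewrite ?mulr_gt0//.
by apply: subset_cube => i; lra.
Qed.

Lemma wmeas_vitali (I : finType) (a : I -> 'I_d -> R) (l : I -> R) (S : {set I})
    (E : set (euclid R d)) omega : nweight omega -> (forall i, 0 < l i) ->
  (forall x, E x -> exists2 i, i \in S & triple (a i) (l i) x) ->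
  (wmeas omega E <=
    (\sum_(i in S) mass omega (fun k => a i k - l i) (3 * l i))%:E)%E.
Proof.
move=> w l0 cov; rewrite -sumEFin.
have [w0 mw _] := w.
under eq_bigr do rewrite -massE ?mulr_gt0//.
apply: integral_le_sum_cover; last exact: cov.
- by move=> i; exact: measurable_cube.
- by move=> x; rewrite lee_fin.
- exact/measurable_EFinP.
Qed.

End cubes.

(** * Replacing a weight by its positive part *)

Section weights.
Context {R : realType} {d : nat}.
Implicit Types (sigma omega : euclid R d -> R).

Lemma cubes_exhaust : [set: euclid R d] =
  \bigcup_k cube (fun=> - k.+1%:R : R) (2 * k.+1%:R).
Proof.
apply/esym; rewrite -subTset => x _.
have [k xk] : exists k : nat, forall i, `|tnth x i| <= k.+1%:R.
  exists (\max_(i < d) Num.truncn `|tnth x i|) => i.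
  apply: (@le_trans _ _ (Num.truncn `|tnth x i|).+1%:R).
    by apply: ltW; apply: truncnS_gt.
  by rewrite ler_nat ltnS (leq_bigmax i).
by exists k => // i; have := xk i; rewrite ler_norml => /andP[]; lra.
Qed.

Definition pos_part sigma x := Num.max (sigma x) 0.

Lemma weight_measurable sigma : weight sigma -> measurable_fun setT sigma.
Proof.
move=> [int _]; rewrite cubes_exhaust; apply/measurable_fun_bigcup.
  by move=> k; exact: measurable_cube.
move=> k; apply/measurable_EFinP.
apply: (measurable_int lebesgue); apply: int.
by exists (fun=> - k.+1%:R), (2 * k.+1%:R); rewrite mulr_gt0.
Qed.

Lemma wmeas_pos_part sigma E : weight sigma -> measurable E ->
  wmeas (pos_part sigma) E = wmeas sigma E.
Proof.
move=> [_ sgt0] mE; rewrite /wmeas.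
under [RHS]eq_integral do rewrite -[(sigma _)%:E]mul1e.
by rewrite integral_mul_pos_part//; apply: eq_integral => x _; rewrite mul1e.
Qed.

(** If the mass of a cube were 0, almost every point of the cube would satisfy
    both sigma = 0 and sigma > 0, although the cube has positive Lebesgue
    measure. *)
Lemma weight_pos_part sigma : weight sigma -> nweight (pos_part sigma).
Proof.
move=> ws; have [int [N [mN N0 sN]]] := ws.
have ms := weight_measurable ws.
have mp : measurable_fun setT (pos_part sigma).
  exact: measurable_maxr.
split => //.
  by move=> x; rewrite /pos_part le_max lexx orbT.
move=> a l l0; have mQ := measurable_cube a l.
have p0 : (0 <= wmeas (pos_part sigma) (cube a l))%E.
  by apply: integral_ge0 => x _; rewrite lee_fin le_max lexx orbT.
apply/andP; split; last first.
  rewrite wmeas_pos_part// ltey_eq; apply/orP; left.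
  by apply: integrable_fin_num => //; apply: int; exists a, l.
rewrite lt_neqAle p0 andbT eq_sym; apply/eqP => int0.
have : ae_eq lebesgue (cube a l) (EFin \o pos_part sigma) (cst 0%E).
  apply/ae_eq_integral_abs => //; first exact/measurable_EFinP/measurable_funTS.
  rewrite -[RHS]int0; apply: eq_integral => x _.
  by rewrite /= ger0_norm// le_max lexx orbT.
move=> [M [mM M0 sM]].
have : (lebesgue (cube a l) <= lebesgue (N `|` M))%E.
  apply: le_measure; rewrite ?inE//; first exact: measurableU.
  move=> x Qx; apply: contrapT => /not_orP[Nx Mx].
  have s0 : 0 < sigma x by apply: contrapT => s0; apply: Nx; exact: sN.
  apply: Mx; apply: sM => /(_ Qx)/= -[]; apply/eqP.
  by rewrite gt_eqF// lt_max s0.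
have -> : lebesgue (N `|` M) = 0%E by apply: (eq_trans (measureU0 _ _ _) N0).
rewrite leNgt lebesgue_box ?lerDl ?(ltW l0)// => [|i]; last first.
  by rewrite lerDl ltW.
rewrite lte_fin => /negP; apply; apply: prodr_gt0 => i _.
by rewrite addrC addKr.
Qed.

Lemma er_map_ge0 (Phi : R -> R) z : young Phi -> (0 <= z)%E -> (0 <= er_map Phi z)%E.
Proof. by case: z => //= r yPhi; rewrite !lee_fin => /(young_ge0 yPhi). Qed.

Lemma normc_ge0 (z : R[i]) : 0 <= Normc.normc z.
Proof. by case: z => a b; exact: sqrtr_ge0. Qed.

Section pos_part_invariance.
Context sigma (ws : weight sigma).
Local Open Scope ereal_scope.

Lemma doubling_pos_part : doubling sigma -> doubling (pos_part sigma).
Proof.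
move=> [C [C1 dbl]]; exists C; split=> // a a' l l' *.
by rewrite !wmeas_pos_part//; [exact: dbl|exact: measurable_cube|exact: measurable_cube].
Qed.

(** Stated for every g, since it is applied to the maximal function. *)
Lemma luxemburg_pos_part (Phi : R -> R) g : young Phi ->
  luxemburg Phi (pos_part sigma) g = luxemburg Phi sigma g.
Proof.
have [_ sgt0] := ws.
move=> yPhi; rewrite /luxemburg; congr ereal_inf; congr (_ @` _).
have E lam : (0 < lam)%R ->
    \int[lebesgue]_x (er_map Phi (`|g x| / lam%:E) * (pos_part sigma x)%:E) =
    \int[lebesgue]_x (er_map Phi (`|g x| / lam%:E) * (sigma x)%:E).
  move=> lam0; rewrite [RHS]integral_mul_pos_part// => x.
  by rewrite er_map_ge0// mule_ge0// inve_ge0 lee_fin ltW.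
by apply/seteqP; split => lam /= [lam0]; rewrite E.
Qed.

Lemma integral_modulus_pos_part (f : euclid R d -> R[i]) E : measurable E ->
  \int[lebesgue]_(y in E) (modulus f y * (pos_part sigma y)%:E) =
  \int[lebesgue]_(y in E) (modulus f y * (sigma y)%:E).
Proof.
have [_ sgt0] := ws; move=> mE; rewrite [RHS]integral_mul_pos_part// => x.
by rewrite lee_fin; exact: normc_ge0.
Qed.
End pos_part_invariance.

Lemma maximal_pos_part n (sigma : 'I_n -> euclid R d -> R) f :
  (forall i, weight (sigma i)) ->
  maximal (fun i => pos_part (sigma i)) f = maximal sigma f.
Proof.
move=> ws; apply/funext => x; rewrite /maximal; congr ereal_sup.
apply: eq_imagel => Q [a [l [l0 ->]]]; apply: eq_bigr => i _.
have mQ := measurable_cube a l.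
by rewrite (wmeas_pos_part (ws i) mQ) (integral_modulus_pos_part (ws i) _ mQ).
Qed.

Lemma K_constant_pos_part n Phi Psi (sigma : 'I_n -> euclid R d -> R) omega :
  (forall i, weight (sigma i)) -> weight omega ->
  K_constant Phi Psi (fun i => pos_part (sigma i)) (pos_part omega) =
  K_constant Phi Psi sigma omega.
Proof.
move=> ws wo; rewrite /K_constant; congr ereal_sup.
apply: eq_imagel => Q [a [l [l0 ->]]]; have mQ := measurable_cube a l.
rewrite (wmeas_pos_part wo mQ); congr (_ * _)%E; apply: eq_bigr => i _.
by rewrite (wmeas_pos_part (ws i) mQ).
Qed.

Lemma bounded_by_pos_part n (Phi : 'I_n -> R -> R) Psi
    (sigma : 'I_n -> euclid R d -> R) omega C :
  (forall i, weight (sigma i)) -> weight omega ->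
  (forall i, young (Phi i)) -> young Psi ->
  bounded_by (maximal (fun i => pos_part (sigma i))) Phi
    (fun i => pos_part (sigma i)) Psi (pos_part omega) C <->
  bounded_by (maximal sigma) Phi sigma Psi omega C.
Proof.
move=> ws wo yPhi yPsi.
have lP i g := luxemburg_pos_part (ws i) g (yPhi i).
split=> bC f fO.
  have := bC f; rewrite luxemburg_pos_part// maximal_pos_part//.
  under eq_bigr do rewrite lP.
  by apply=> j; rewrite /in_Orlicz lP; exact: fO.
rewrite luxemburg_pos_part// maximal_pos_part//.
under eq_bigr do rewrite lP.
by apply: bC => j; have := fO j; rewrite /in_Orlicz lP.
Qed.

End weights.

(** * Necessity of the finiteness of the constant *)

Section necessity.
Context {R : realType} {d : nat}.
Implicit Types (sigma omega : euclid R d -> R) (a : 'I_d -> R) (l : R).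

Lemma prod_EFin (I : finType) (F : I -> R) :
  (\prod_i (F i)%:E = (\prod_i F i)%:E)%E.
Proof. by apply: (big_ind2 (fun x y => x = y%:E)) => // x1 x2 y1 y2 -> ->. Qed.

Definition K_term n (Phi : 'I_n -> R -> R) Psi (sigma : 'I_n -> euclid R d -> R)
    omega a l :=
  mass omega a l * \prod_i Psi (ginv (Phi i) (mass (sigma i) a l)^-1).

Lemma K_termE n (Phi : 'I_n -> R -> R) Psi (sigma : 'I_n -> euclid R d -> R)
    omega a l : (forall i, nweight (sigma i)) -> nweight omega -> 0 < l ->
  (wmeas omega (cube a l) *
    \prod_i er_map (Psi \o ginv (Phi i)) (wmeas (sigma i) (cube a l))^-1
  = (K_term Phi Psi sigma omega a l)%:E)%E.
Proof.
move=> ws wo l0; rewrite /K_term EFinM -prod_EFin massE//; congr (_ * _)%E.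
by apply: eq_bigr => i _; rewrite massE// inver gt_eqF// mass_gt0.
Qed.

Lemma K_constant_le n (Phi : 'I_n -> R -> R) Psi (sigma : 'I_n -> euclid R d -> R)
    omega a l : (forall i, nweight (sigma i)) -> nweight omega -> 0 < l ->
  ((K_term Phi Psi sigma omega a l)%:E <= K_constant Phi Psi sigma omega)%E.
Proof.
move=> ws wo l0; rewrite -K_termE//; apply: ereal_sup_ubound.
by exists (cube a l) => //; exists a, l.
Qed.

Lemma K_term_gt0 n (Phi : 'I_n -> R -> R) Psi (sigma : 'I_n -> euclid R d -> R)
    omega a l : (forall i, young (Phi i)) -> young Psi ->
  (forall i, nweight (sigma i)) -> nweight omega -> 0 < l ->
  0 < K_term Phi Psi sigma omega a l.
Proof.
move=> yPhi yPsi ws wo l0; rewrite mulr_gt0 ?mass_gt0//; apply: prodr_gt0 => i _.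
by rewrite young_gt0// ginv_gt0// invr_gt0 mass_gt0.
Qed.

Lemma luxemburg_ge0 Phi sigma g : (0 <= @luxemburg R d Phi sigma g)%E.
Proof. by apply: le_ereal_inf_tmp => _ [lam [lam0 _] <-]; rewrite lee_fin ltW. Qed.

(** The factor 2 is there because the infimum defining the norm need not be
    attained. *)
Lemma luxemburg_lower Psi omega (g : euclid R d -> \bar R) a l v C :
  young Psi -> nweight omega -> 0 < l -> 0 < C -> 0 <= v ->
  (forall x, cube a l x -> (v%:E <= g x)%E) ->
  (luxemburg Psi omega g <= C%:E)%E ->
  Psi (v / (2 * C)) * mass omega a l <= 1.
Proof.
move=> yPsi w l0 C0 v0 gv lC.
have [lam [lam0 int] lamC] : exists2 lam, 0 < lam /\ (\int[lebesgue]_x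
    (er_map Psi (`|g x| / lam%:E) * (omega x)%:E) <= 1)%E & lam < 2 * C.
  have : (luxemburg Psi omega g < (2 * C)%:E)%E.
    by apply: le_lt_trans lC _; rewrite lte_fin; lra.
  move=> /ereal_inf_lt[_ [lam lamP <-] lamC].
  by exists lam => //; rewrite -lte_fin.
have [w0 mw _] := w; have mQ := measurable_cube a l.
rewrite -lee_fin -integral_cube_scale//; last first.
  by rewrite young_ge0// divr_ge0// mulr_ge0// ltW.
apply: le_trans int.
have le_Psi x : cube a l x ->
    ((Psi (v / (2 * C)))%:E <= er_map Psi (`|g x| / lam%:E))%E.
  move=> Qx; have := gv _ Qx; case: (g x) => [r| |]; last by rewrite leeNy_eq.
    2: by move=> _; rewrite inver gt_eqF// gt0_mulye ?lte_fin ?invr_gt0//= leey.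
  rewrite lee_fin => vr; rewrite inver gt_eqF//= lee_fin.
  apply: young_le => //; first by rewrite divr_ge0// mulr_ge0// ltW.
  apply: ler_pM => //; first by rewrite invr_ge0 mulr_ge0// ltW.
    by rewrite (le_trans vr)// ler_norm.
  by rewrite lef_pV2 ?posrE ?mulr_gt0// ltW.
rewrite integral_mkcond; apply: ge0_le_integral_any => x _.
  rewrite erestrict_ge0// => y _.
  by rewrite lee_fin mulr_ge0// young_ge0// divr_ge0// mulr_ge0// ltW.
rewrite patchE; case: ifPn => [/set_mem Qx|_].
  by apply: lee_wpmul2r; [rewrite lee_fin|exact: le_Psi].
rewrite mule_ge0 ?lee_fin//.
by rewrite er_map_ge0// mule_ge0// inve_ge0 lee_fin ltW.
Qed.

Section test_function.
Context (Phi : R -> R) sigma a l (yPhi : young Phi) (w : nweight sigma) (l0 : 0 < l).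

(** The height makes Phi(height) * sigma(Q) equal to 1, which bounds the
    norm by 1. *)
Definition extremal (x : euclid R d) : R[i] :=
  (ginv Phi (mass sigma a l)^-1 * \1_(cube a l) x)%:C%C.

Let v := ginv Phi (mass sigma a l)^-1.

Lemma extremal_gt0 : 0 < v.
Proof. by apply: ginv_gt0 => //; rewrite invr_gt0 mass_gt0. Qed.

Lemma modulus_extremal x : modulus extremal x = (v * \1_(cube a l) x)%:E.
Proof.
rewrite /modulus /extremal /= expr0n/= addr0 sqrtr_sqr ger0_norm//.
by rewrite mulr_ge0// ltW// extremal_gt0.
Qed.

Lemma integral_extremal :
  (\int[lebesgue]_(y in cube a l) (modulus extremal y * (sigma y)%:E) =
    (v * mass sigma a l)%:E)%E.
Proof.
rewrite -integral_cube_scale//; last exact: ltW extremal_gt0.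
by apply: eq_integral => x Qx; rewrite modulus_extremal indicE Qx mulr1.
Qed.

Lemma extremal_Orlicz :
  in_Orlicz Phi sigma extremal /\ (luxemburg Phi sigma (modulus extremal) <= 1)%E.
Proof.
suff l1 : (luxemburg Phi sigma (modulus extremal) <= 1)%E.
  split; last exact: l1.
  split; last by apply: le_lt_trans l1 _; exact: ltey.
  split; last exact: measurable_cst.
  have mQ : measurable_fun setT (\1_(cube a l) : euclid R d -> R).
    exact/measurable_indic/measurable_cube.
  exact: (measurable_funM (measurable_cst v) mQ).
apply: ereal_inf_lbound; exists 1; last by [].
split; first exact: ltr01.
have int1 : (\int[lebesgue]_(y in cube a l) ((Phi v)%:E * (sigma y)%:E) = 1)%E.
  rewrite integral_cube_scale//; last by rewrite young_ge0// ltW// extremal_gt0.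
  rewrite ginvK ?invr_ge0 ?(ltW (mass_gt0 _ _ _))//.
  by rewrite mulVf// gt_eqF// mass_gt0.
rewrite -[leRHS]int1 [leRHS]integral_mkcond le_eqVlt; apply/orP; left; apply/eqP.
apply: eq_integral => x _; rewrite modulus_extremal inver oner_eq0 invr1 mule1/=.
rewrite ger0_norm; last by rewrite mulr_ge0// ltW// extremal_gt0.
rewrite patchE indicE; have [_|_] := boolP (x \in cube a l).
  by rewrite mulr1.
by rewrite mulr0 young0// mul0e.
Qed.

End test_function.

(** On Q the maximal function of the extremal functions is at least the
    product of their heights, and quasi-multiplicativity compares Psi of this
    product with the product that enters the constant. *)
Lemma necessity n (Phi : 'I_n -> R -> R) Psi (sigma : 'I_n -> euclid R d -> R)
    omega B C :
  (forall i, young (Phi i)) -> young Psi -> 0 < B -> quasi_mult B Psi ->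
  (forall i, nweight (sigma i)) -> nweight omega -> 0 < C ->
  bounded_by (maximal sigma) Phi sigma Psi omega C ->
  (K_constant Phi Psi sigma omega <= (B ^+ n.+1 / Psi 1 * Psi (2 * C))%:E)%E.
Proof.
move=> yPhi yPsi B0 qm ws wo C0 bC.
apply: ge_ereal_sup => _ [_ [a [l [l0 ->]]] <-].
rewrite K_termE// lee_fin.
pose f i := extremal (Phi i) (sigma i) a l.
pose v i := ginv (Phi i) (mass (sigma i) a l)^-1.
have v0 i : 0 < v i by exact: extremal_gt0.
have p0 : 0 < \prod_i v i by exact: prodr_gt0.
have fO i := extremal_Orlicz a (yPhi i) (ws i) l0.
have Mv x : cube a l x -> ((\prod_i v i)%:E <= maximal sigma f x)%E.
  move=> Qx; apply: ereal_sup_ubound; exists (cube a l); first by exists a, l.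
  rewrite -prod_EFin; apply: eq_bigr => i _.
  rewrite integral_extremal// massE// inver gt_eqF ?mass_gt0// indicE mem_set//.
  by rewrite mul1e -EFinM mulrCA mulVf ?mulr1// gt_eqF// mass_gt0.
have lC : (luxemburg Psi omega (maximal sigma f) <= C%:E)%E.
  apply: (le_trans (bC f (fun j => (fO j).1))).
  rewrite -[leRHS]mule1 lee_pmul2l// ?lte_fin//.
  suff /andP[] : (0 <= \prod_j luxemburg (Phi j) (sigma j) (modulus (f j)) <= 1)%E by [].
  apply: (big_ind (fun z => (0 <= z <= 1)%E)).
  - by rewrite lexx lee01.
  - move=> x y /andP[x0 x1] /andP[y0 y1]; rewrite mule_ge0//=.
    by rewrite -[leRHS]mule1 lee_pmul.
  - by move=> i _; rewrite luxemburg_ge0 (fO i).2.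
have low := luxemburg_lower yPsi wo l0 C0 (ltW p0) Mv lC.
have C20 : 0 < 2 * C by rewrite mulr_gt0.
have P1 := young_gt0 yPsi ltr01; have m0 := mass_gt0 wo a l0.
have P2 := young_gt0 yPsi C20.
have prod_le := quasi_mult_prod yPsi B0 qm v0.
have := quasi_mult_upper yPsi qm (ltW (divr_gt0 p0 C20)) (ltW C20).
rewrite divfK ?gt_eqF// => up.
rewrite /K_term [leRHS]mulrAC ler_pdivlMr// -mulrA (mulrC _ (Psi 1)).
apply: (@le_trans _ _ (mass omega a l * (B ^+ n * Psi (\prod_i v i)))).
  by rewrite ler_pM2l.
apply: (@le_trans _ _ (mass omega a l *
    (B ^+ n * (B * (Psi (\prod_i v i / (2 * C)) * Psi (2 * C)))))).
  by rewrite ler_pM2l// ler_wpM2l// exprn_ge0// ltW.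
have -> : mass omega a l *
    (B ^+ n * (B * (Psi (\prod_i v i / (2 * C)) * Psi (2 * C)))) =
  B ^+ n.+1 * Psi (2 * C) * (Psi (\prod_i v i / (2 * C)) * mass omega a l).
  by rewrite exprS; ring.
by rewrite -[leRHS]mulr1 ler_wpM2l// mulr_ge0 ?exprn_ge0 ?(ltW B0)// ltW.
Qed.

End necessity.

(** * Two or more functions *)

Section degenerate.
Context {R : realType} {d : nat} (d_gt0 : (0 < d)%N).
Implicit Types (sigma omega : euclid R d -> R) (a : 'I_d -> R) (l : R).

(** Near the corner opposite to a, the cube of side 2l contains a cube of side
    l/2 which misses the cube of side l and carries a fixed fraction of the
    mass. *)
Lemma mass_half sigma : nweight sigma -> doubling sigma ->
  exists theta, 0 <= theta < 1 /\ forall a l, 0 < l ->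
    mass sigma a l <= theta * mass sigma a (2 * l).
Proof.
move=> w /(mass_doubling w)[C C1 dbl].
have C0 : 0 < C by exact: lt_trans C1.
have C20 : 0 < C ^+ 2 by rewrite exprn_gt0.
exists (1 - (C ^+ 2)^-1); split.
  by rewrite subr_ge0 ltrBlDr ltrDl invr_gt0 C20 invf_le1// expr_ge1 ?ltW.
move=> a l l0.
pose b i := a i + 3 / 2 * l; pose h := l / 2.
have h0 : 0 < h by rewrite divr_gt0.
have l20 : 0 < 2 * l by rewrite mulr_gt0.
have corner : mass sigma a (2 * l) <= C ^+ 2 * mass sigma b h.
  apply: (@le_trans _ _ (C * mass sigma (fun i => a i + l) l)).
    by apply: dbl => //; apply: subset_cube => i; lra.
  rewrite expr2 -mulrA ler_pM2l//; apply: dbl => //; last by rewrite /h; lra.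
  by apply: subset_cube => i; rewrite /b /h; lra.
have [s0 ms _] := w.
have sum : mass sigma a l + mass sigma b h <= mass sigma a (2 * l).
  rewrite -lee_fin EFinD -!massE// /wmeas -ge0_integral_setU.
  - apply: ge0_subset_integral.
    + by apply: measurableU; exact: measurable_cube.
    + exact: measurable_cube.
    + by apply/measurable_EFinP; exact: measurable_funTS.
    + by move=> x _; rewrite lee_fin.
    + rewrite subUset; split; apply: subset_cube => i; rewrite /b /h; lra.
  - exact: measurable_cube.
  - exact: measurable_cube.
  - by apply/measurable_EFinP; exact: measurable_funTS.
  - by move=> x _; rewrite lee_fin.
  - apply/disj_setPS => x [Qx Qx'].
    have := Qx (Ordinal d_gt0); have := Qx' (Ordinal d_gt0).
    by rewrite /b /h; lra.
have corner' : mass sigma a (2 * l) / C ^+ 2 <= mass sigma b h.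
  by rewrite ler_pdivrMr// (mulrC (mass sigma b h)).
rewrite mulrBl mul1r [_^-1 * _]mulrC lerBrDr.
by apply: le_trans sum; rewrite lerD2l.
Qed.

Lemma mass_small sigma : nweight sigma -> doubling sigma ->
  exists theta, 0 <= theta < 1 /\ forall a N, 
    mass sigma a (2 ^- N) <= theta ^+ N * mass sigma a 1.
Proof.
move=> w dbl; have [theta [/andP[t0 t1] half]] := mass_half w dbl.
exists theta; rewrite t0 t1; split=> // a; elim=> [|N IH].
  by rewrite !expr0 invr1 mul1r.
have p2 : 0 < (2 : R) ^- N.+1 by rewrite invr_gt0 exprn_gt0.
apply: (le_trans (half a _ p2)).
have -> : 2 * 2 ^- N.+1 = 2 ^- N :> R.
  by rewrite exprS invfM mulrA divff ?mul1r.
by rewrite exprS -mulrA ler_wpM2l.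
Qed.

(** Otherwise omega(Q) <= kappa u_0(Q) u_1(Q) for the cubes Q of a bounded
    region, where u_i is the mass of sigma_i normalized to be at most 1.  Among
    the cubes of side 2^-N covering the unit cube, Vitali's lemma selects
    disjoint ones: their values of u_1 add up to at most 1, while each value of
    u_0 is at most theta^N.  Letting N grow gives omega mass 0 on the unit
    cube. *)
Lemma K_constant_infinite n (Phi : 'I_n -> R -> R) Psi
    (sigma : 'I_n -> euclid R d -> R) omega :
  (1 < n)%N -> (forall i, young (Phi i)) -> young Psi ->
  (forall i, nondecreasing_pos (fun t => Psi t / Phi i t)) ->
  (forall i, nweight (sigma i)) -> (forall i, doubling (sigma i)) ->
  nweight omega -> K_constant Phi Psi sigma omega = +oo%E.
Proof.
move=> n1 yPhi yPsi ratio ws dbl wo.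
apply: contrapT => /eqP; rewrite -ltey => Koo.
have bound : exists k, forall a l, 0 < l -> K_term Phi Psi sigma omega a l <= k.
  have := fun a (l : R) => K_constant_le Phi Psi a ws wo (l := l).
  move: Koo; case: K_constant => [k _ h| // |_ h].
    by exists k => a l l0; rewrite -lee_fin; exact: h.
  by have := h (fun=> 0) 1 ltr01.
have [k kP] := bound.
pose M i := mass (sigma i) (fun=> - 1) 4.
have M0 i : 0 < M i by exact: mass_gt0.
pose inside a l := 0 < l /\ (cube a l : set (euclid R d)) `<=` cube (fun=> - 1) 4.
pose u i a l := mass (sigma i) a l / M i.
have u_gt0 i a l : inside a l -> 0 < u i a l.
  by move=> [l0 _]; rewrite divr_gt0// mass_gt0.
have u_le1 i a l : inside a l -> u i a l <= 1.
  by move=> [l0 sub]; rewrite ler_pdivrMr// mul1r mass_le.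
pose t i := ginv (Phi i) (M i)^-1.
have t0 i : 0 < t i by rewrite ginv_gt0// invr_gt0.
(* Psi / Phi_i is compared at t i and at the larger height attached to the cube. *)
have Psi_low i a l : inside a l ->
    Psi (t i) <= u i a l * Psi (ginv (Phi i) (mass (sigma i) a l)^-1).
  move=> [l0 sub]; set s := ginv _ _.
  have m0 : 0 < mass (sigma i) a l by exact: mass_gt0.
  have mM : mass (sigma i) a l <= M i by exact: mass_le.
  have s0 : 0 < s by rewrite ginv_gt0// invr_gt0.
  have ts : t i <= s.
    apply: le_ginv => //; last by rewrite invr_ge0 ltW.
    by rewrite ginvK ?invr_ge0 ?(ltW (M0 i))// lef_pV2 ?posrE.
  have := ratio i (t i) s; rewrite !in_itv/= t0 s0 => /(_ isT isT ts).
  rewrite !ginvK ?invr_ge0 ?(ltW (M0 i)) ?(ltW m0)// !invrK -ler_pdivlMr// => h.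
  by rewrite /u mulrAC (mulrC (mass _ _ _)).
pose i0 : 'I_n := Ordinal (ltnW n1); pose i1 : 'I_n := Ordinal n1.
pose kappa := k / \prod_i Psi (t i).
have P0 : 0 < \prod_i Psi (t i) by apply: prodr_gt0 => i _; exact: young_gt0.
have decay a l : inside a l -> mass omega a l <= kappa * (u i0 a l * u i1 a l).
  move=> ins; have [l0 _] := ins.
  have m0 := mass_gt0 wo a l0.
  have prod_le : \prod_i Psi (t i) <= u i0 a l * u i1 a l *
      \prod_i Psi (ginv (Phi i) (mass (sigma i) a l)^-1).
    apply: (@le_trans _ _ (\prod_i (u i a l *
        Psi (ginv (Phi i) (mass (sigma i) a l)^-1)))).
      by apply: ler_prod => i _; rewrite young_ge0 ?Psi_low// ltW.
    rewrite big_split/= ler_wpM2r//.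
      apply: prodr_ge0 => i _; apply: young_ge0 => //; apply: ginv_ge0 => //.
      by rewrite invr_ge0 ltW// mass_gt0.
    rewrite (bigD1 i0)//= (bigD1 i1)//= mulrA ler_piMr//.
      by rewrite mulr_ge0// ltW// u_gt0.
    by apply: prodr_ile1 => i _; rewrite u_le1// andbT ltW// u_gt0.
  rewrite /kappa mulrAC ler_pdivlMr//.
  apply: (@le_trans _ _ (mass omega a l * (u i0 a l * u i1 a l *
      \prod_i Psi (ginv (Phi i) (mass (sigma i) a l)^-1)))).
    by rewrite ler_pM2l.
  rewrite mulrCA (mulrC k) ler_wpM2l ?kP//.
  by rewrite mulr_ge0// ltW// u_gt0.
have [C0 C01 [_ tr0]] := mass_triple (ws i0) (dbl i0).
have [C1 C11 [_ tr1]] := mass_triple (ws i1) (dbl i1).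
have C0gt0 : 0 < C0 by exact: lt_trans C01.
have C1gt0 : 0 < C1 by exact: lt_trans C11.
have [theta [/andP[th0 th1] small]] := mass_small (ws i0) (dbl i0).
have k_ge0 : 0 <= kappa.
  rewrite divr_ge0 ?(ltW P0)//; apply: le_trans (kP (fun=> 0) 1 ltr01).
  rewrite mulr_ge0 ?(ltW (mass_gt0 _ _ _))// prodr_ge0// => i _.
  by rewrite young_ge0// ginv_ge0// invr_ge0 ltW// mass_gt0.
have zero N : mass omega (fun=> 0) 1 <= kappa * (C0 * C1) * theta ^+ N.
  set l : R := 2 ^- N.
  have l0 : 0 < l by rewrite invr_gt0 exprn_gt0.
  have l1 : l <= 1 by rewrite invf_le1 ?exprn_gt0// exprn_ege1// ler1n.
  have lN : l * (2 ^ N)%:R = 1 by rewrite natrX mulVf// expf_neq0.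
  pose I := {ffun 'I_d -> 'I_(2 ^ N).+1}.
  pose a (g : I) i := l * (g i)%:R.
  have a01 g i : 0 <= a g i <= 1.
    apply/andP; split; first by rewrite mulr_ge0// ltW.
    by rewrite -[leRHS]lN ler_pM2l// ler_nat -ltnS.
  have inQ g : inside (a g) l.
    by split=> //; apply: subset_cube => i; have := a01 g i; lra.
  have in3 g : inside (fun i => a g i - l) (3 * l).
    split; first by rewrite mulr_gt0.
    by apply: subset_cube => i; have := a01 g i; lra.
  have [S [_ disj cov]] := @vitali_cubes R d I a (fun=> l) [set: I]%SET (fun=> l0).
  have sum1 : \sum_(g in S) mass (sigma i1) (a g) l <= M i1.
    rewrite -lee_fin -sumEFin.
    under eq_bigr do rewrite -massE//.
    rewrite /M -massE//; apply: le_sum_integral_disjoint.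
    - by move=> g; exact: measurable_cube.
    - by have [s0 _ _] := ws i1; move=> x; rewrite lee_fin.
    - by have [_ ms _] := ws i1; exact/measurable_EFinP.
    - exact: measurable_cube.
    - by move=> g _; case: (inQ g).
    - exact: disj.
  have cover : mass omega (fun=> 0) 1 <=
      \sum_(g in S) mass omega (fun i => a g i - l) (3 * l).
    rewrite -lee_fin -massE//; apply: (@wmeas_vitali _ _ _ a (fun=> l)) => //.
    move=> x Qx.
    (* When x_i = 1 the index is 2^N itself, hence the extra grid layer. *)
    pose g : I := [ffun i => inord (Num.truncn (tnth x i * (2 ^ N)%:R))].
    have [g' g'S sub] := cov g (finset.in_setT _).
    exists g' => //; apply: sub => i.
    have := Qx i; rewrite add0r => /andP[x0 x1].
    have y0 : 0 <= tnth x i * (2 ^ N)%:R by rewrite mulr_ge0.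
    have := truncn_itv y0; set m := Num.truncn _ => /andP[my ym].
    have mN : (m < (2 ^ N).+1)%N.
      rewrite ltnS -(ler_nat R) (le_trans my)// ler_piMl//.
    rewrite /a ffunE inordK// -/m.
    move: my ym; rewrite -(ler_pM2l l0) -(ltr_pM2l l0) mulrCA lN mulr1 => -> /=.
    by rewrite -natr1 mulrDr mulr1 => /ltW.
  apply: (le_trans cover).
  apply: (@le_trans _ _ (\sum_(g in S) kappa * (C0 * C1) * theta ^+ N *
      u i1 (a g) l)).
    apply: ler_sum => g _; apply: (le_trans (decay _ _ (in3 g))).
    rewrite -(mulrA (kappa * _)) -(mulrA kappa) ler_wpM2l//.
    apply: (@le_trans _ _ ((C0 * u i0 (a g) l) * (C1 * u i1 (a g) l))).
      apply: ler_pM; rewrite ?(ltW (u_gt0 _ _ _ _))//.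
        by rewrite /u mulrA ler_pM2r ?invr_gt0// tr0.
      by rewrite /u mulrA ler_pM2r ?invr_gt0// tr1.
    rewrite mulrACA ler_pM2l ?mulr_gt0// ler_pM2r ?u_gt0//.
    rewrite ler_pdivrMr//; apply: (le_trans (small _ _)).
    rewrite ler_wpM2l ?exprn_ge0//; apply: mass_le => //.
    by apply: subset_cube => i; have := a01 g i; lra.
  rewrite -mulr_sumr -[leRHS]mulr1 ler_wpM2l//.
    by rewrite mulr_ge0 ?exprn_ge0// mulr_ge0// mulr_ge0// ltW.
  by rewrite -mulr_suml ler_pdivrMr// mul1r.
have m0 := mass_gt0 wo (fun=> 0) ltr01.
have cvg0 : (fun N => kappa * (C0 * C1) * theta ^+ N) @ \oo --> 0.
  by rewrite -[0](mulr0 (kappa * (C0 * C1))); apply: cvgMr; apply: cvg_expr; rewrite ger0_norm.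
suff : mass omega (fun=> 0) 1 <= 0 by rewrite leNgt m0.
rewrite -[leRHS](cvg_lim _ cvg0)//; apply: limr_ge; first exact: cvgP cvg0.
by apply: nearW; exact: zero.
Qed.

End degenerate.

(** * One function: the level set estimate *)

Section one_function.
Context {R : realType} {d : nat}.
Context (Phi Psi : R -> R) (sigma : euclid R d -> R) (B C : R).
Hypotheses (yPhi : young Phi) (yPsi : young Psi).
Hypotheses (B0 : 0 < B) (qm : quasi_mult B Psi).
Hypothesis ratio : nondecreasing_pos (fun t => Psi t / Phi t).
Hypothesis w : nweight sigma.
Hypothesis C1 : 1 < C.
Hypothesis mass_tripled : forall a l, 0 < l ->
  mass sigma (fun i => a i - l) (3 * l) <= C * mass sigma a l.

Let C0 : 0 < C. Proof. exact: lt_trans C1. Qed.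

Section level_sets.
Context (g : euclid R d -> R) (g0 : forall x, 0 <= g x).
Hypothesis mg : measurable_fun setT g.
Hypothesis g1 : (\int[lebesgue]_x (Phi (g x) * sigma x)%:E <= 1)%E.
Context (omega : euclid R d -> R) (K : R) (wo : nweight omega).
Hypothesis K_bound : forall a l, 0 < l ->
  mass omega a l * Psi (ginv Phi (mass sigma a l)^-1) <= K.

Definition tail t x := if t < g x then g x else 0.

Lemma tail_ge0 t x : 0 <= tail t x.
Proof. by rewrite /tail; case: ifP. Qed.

Lemma measurable_tail t : measurable_fun setT (tail t).
Proof.
apply: measurable_fun_ifT; [|exact: mg|exact: measurable_cst].
exact: (measurable_fun_ltr (measurable_cst t) mg).
Qed.

Lemma measurable_density (u : euclid R d -> R) : measurable_fun setT u ->
  measurable_fun setT (fun x => (u x * sigma x)%:E).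
Proof.
have [_ ms _] := w; move=> mu; apply/measurable_EFinP.
exact: (measurable_funM mu ms).
Qed.

Lemma density_ge0 (u : euclid R d -> R) x : (forall x, 0 <= u x) ->
  (0 <= (u x * sigma x)%:E)%E.
Proof. by have [s0 _ _] := w; move=> u0; rewrite lee_fin mulr_ge0. Qed.

Lemma integral_densityZ k (u : euclid R d -> R) : 0 <= k ->
  (forall x, 0 <= u x) -> measurable_fun setT u ->
  (\int[lebesgue]_x (k%:E * (u x * sigma x)%:E) =
    k%:E * \int[lebesgue]_x (u x * sigma x)%:E)%E.
Proof.
move=> k0 u0 mu; apply: ge0_integralZl_EFin k0; first exact: measurableT.
  by move=> x _; exact: density_ge0.
exact: measurable_density.
Qed.

(** Chebyshev's inequality for Phi: beyond t the ratio g / Phi(g) is at most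
    t / Phi(t). *)
Lemma integral_tail_le t : 0 < t ->
  (\int[lebesgue]_x (tail t x * sigma x)%:E <= (t / Phi t)%:E)%E.
Proof.
have [s0 ms _] := w; move=> t0; have Pt := young_gt0 yPhi t0.
have tP0 : 0 <= t / Phi t by rewrite divr_ge0 ?ltW.
have mP := young_measurable yPhi g0 mg.
have Pg0 x : 0 <= Phi (g x) by exact: young_ge0.
apply: (@le_trans _ _ (\int[lebesgue]_x
    ((t / Phi t)%:E * (Phi (g x) * sigma x)%:E))%E).
  apply: ge0_le_integral_any => x _; first exact/density_ge0/tail_ge0.
  rewrite -EFinM lee_fin mulrA ler_wpM2r// /tail; case: ifP => [tg|_]; last first.
    by rewrite mulr_ge0.
  have gx0 : 0 < g x by exact: lt_trans tg.
  have slope : Phi t * g x <= Phi (g x) * t.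
    by rewrite -ler_pdivlMr// mulrAC -ler_pdivrMr// young_slope// ltW.
  by rewrite mulrAC ler_pdivlMr// mulrC (mulrC t).
rewrite integral_densityZ//.
by rewrite -[leRHS]mule1; apply: lee_wpmul2l => //; rewrite lee_fin.
Qed.

Lemma integral_cube_tail_le t a l : 0 < t ->
  (\int[lebesgue]_(x in cube a l) (tail t x * sigma x)%:E <= (t / Phi t)%:E)%E.
Proof.
move=> t0; apply: le_trans (integral_tail_le t0).
apply: ge0_subset_integral.
- exact: measurable_cube.
- exact: measurableT.
- exact/measurable_density/measurable_tail.
- by move=> x _; exact/density_ge0/tail_ge0.
- by [].
Qed.

Lemma integral_cube_split t a l : 0 < t -> 0 < l ->
  (\int[lebesgue]_(x in cube a l) (g x * sigma x)%:E <=
   (\int[lebesgue]_(x in cube a l) (tail t x * sigma x)%:E) +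
     (t * mass sigma a l)%:E)%E.
Proof.
have [s0 ms _] := w; move=> t0 l0.
rewrite -(integral_cube_scale w a (ltW t0) l0) -ge0_integralD.
- apply: ge0_le_integral_any => x _; first exact: density_ge0.
  rewrite -EFinM -EFinD lee_fin -mulrDl ler_wpM2r// /tail.
  by case: ifPn => [_|]; rewrite ?lerDl ?(ltW t0)// add0r -leNgt.
- exact: measurable_cube.
- by move=> x _; exact/density_ge0/tail_ge0.
- exact/measurable_funTS/measurable_density/measurable_tail.
- by move=> x _; rewrite -EFinM lee_fin mulr_ge0// ltW.
- under eq_fun do rewrite -EFinM.
  exact/measurable_funTS/measurable_density/measurable_cst.
Qed.

Definition avg a l :=
  fine (\int[lebesgue]_(x in cube a l) (g x * sigma x)%:E) / mass sigma a l.

Lemma integral_cubeE a l : 0 < l ->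
  (\int[lebesgue]_(x in cube a l) (g x * sigma x)%:E =
    (avg a l * mass sigma a l)%:E)%E.
Proof.
move=> l0; rewrite /avg divfK ?gt_eqF ?mass_gt0// fineK// ge0_fin_numE.
  apply: (le_lt_trans (integral_cube_split a ltr01 l0)).
  apply: lte_add_pinfty; last exact: ltry.
  exact: le_lt_trans (integral_cube_tail_le a l ltr01) (ltry _).
by apply: integral_ge0 => x _; exact: density_ge0.
Qed.

Lemma avg_ge0 a l : 0 < l -> 0 <= avg a l.
Proof.
move=> l0; apply: divr_ge0; last exact/ltW/mass_gt0.
by apply: fine_ge0; apply: integral_ge0 => x _; exact: density_ge0.
Qed.

(** The part of g below t contributes at most t sigma(Q) to an integral that
    exceeds 2 t sigma(Q). *)
Lemma mass_le_tail t a l : 0 < t -> 0 < l -> 2 * t < avg a l ->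
  ((t * mass sigma a l)%:E <=
    \int[lebesgue]_(x in cube a l) (tail t x * sigma x)%:E)%E.
Proof.
move=> t0 l0 tavg; have m0 := mass_gt0 w a l0.
have := integral_cube_split a t0 l0; rewrite integral_cubeE//.
have := integral_cube_tail_le a l t0.
have : (0 <= \int[lebesgue]_(x in cube a l) (tail t x * sigma x)%:E)%E.
  by apply: integral_ge0 => x _; exact/density_ge0/tail_ge0.
case: (integral _ _ _) => // X _ _; rewrite -EFinD !lee_fin => split_le.
have : 2 * t * mass sigma a l < avg a l * mass sigma a l by rewrite ltr_pM2r.
by lra.
Qed.

Let c1 := B * Psi C * K.

Lemma K_ge0 : 0 <= K.
Proof.
apply: le_trans (K_bound (fun=> 0) ltr01); rewrite mulr_ge0//.
  exact/ltW/mass_gt0.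
by rewrite young_ge0// ginv_ge0// invr_ge0 ltW// mass_gt0.
Qed.

Lemma c1_ge0 : 0 <= c1.
Proof.
by rewrite /c1 mulr_ge0 ?K_ge0// mulr_ge0 ?(ltW B0)// young_ge0// ltW.
Qed.

(** Let s = Phi^-1(1 / sigma(Q)).  Chebyshev's inequality gives t <= s, hence
    Psi(t) <= Phi(t) sigma(Q) Psi(s) as Psi / Phi is nondecreasing, and doubling
    makes Psi(s) comparable with the value that the hypothesis on omega uses
    for the triple of Q. *)
Lemma cube_level t a l : 0 < t -> 0 < l -> 2 * t < avg a l ->
  ((Psi t * mass omega (fun i => a i - l) (3 * l))%:E <=
   (c1 * (Phi t / t))%:E *
    \int[lebesgue]_(x in cube a l) (tail t x * sigma x)%:E)%E.
Proof.
move=> t0 l0 tavg; have Pt := young_gt0 yPhi t0.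
have tail_le := mass_le_tail t0 l0 tavg.
have c0 : 0 <= c1 * (Phi t / t) by rewrite mulr_ge0 ?c1_ge0// divr_ge0 ?ltW.
apply: (@le_trans _ _ ((c1 * (Phi t / t))%:E * (t * mass sigma a l)%:E)%E); last first.
  by apply: lee_wpmul2l => //; rewrite lee_fin.
set m := mass sigma a l in tail_le *.
have m0 : 0 < m by exact: mass_gt0.
have mV : 0 <= m^-1 by rewrite invr_ge0 ltW.
have ta : t <= ginv Phi m^-1.
  apply: le_ginv => //.
  have := le_trans tail_le (integral_cube_tail_le a l t0); rewrite lee_fin.
  by rewrite ler_pM2l// => mP; rewrite -(invrK (Phi t)) lef_pV2 ?posrE ?invr_gt0.
set s := ginv Phi m^-1 in ta.
have s0 : 0 < s by exact: lt_le_trans ta.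
have PsiPhi : Psi t <= Phi t * m * Psi s.
  have := @ratio t s; rewrite !in_itv/= t0 s0 => /(_ isT isT ta).
  rewrite /s ginvK// invrK ler_pdivrMr// => h.
  by apply: (le_trans h); rewrite mulrC mulrA mulrAC.
have l30 : 0 < 3 * l by rewrite mulr_gt0.
set m3 := mass sigma (fun i => a i - l) (3 * l).
have m30 : 0 < m3 by exact: mass_gt0.
(* By doubling, s / C is below the height attached to the triple. *)
have Psi3 : Psi s <= B * Psi C * Psi (ginv Phi m3^-1).
  have sC : 0 <= s / C by rewrite divr_ge0 ?ltW.
  have sC_le : s / C <= ginv Phi m3^-1.
    apply: le_ginv => //; last by rewrite invr_ge0 ltW.
    have := young_star yPhi (ltW C1) sC.
    rewrite [C * (s / C)]mulrC divfK ?gt_eqF// [X in _ <= X]ginvK// => h.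
    apply: (@le_trans _ _ (m^-1 / C)); first by rewrite ler_pdivlMr// mulrC.
    by rewrite -invfM lef_pV2 ?posrE ?mulr_gt0// mulrC; exact: mass_tripled.
  have := quasi_mult_upper yPsi qm sC (ltW C0); rewrite divfK ?gt_eqF// => h.
  apply: (le_trans h); rewrite -mulrA ler_pM2l// mulrC.
  by rewrite ler_wpM2l ?young_ge0 ?(ltW C0)// young_le.
have w30 := mass_gt0 wo (fun i => a i - l) l30.
rewrite -EFinM lee_fin.
apply: (@le_trans _ _ (Phi t * m * (B * Psi C * Psi (ginv Phi m3^-1)) *
    mass omega (fun i => a i - l) (3 * l))).
  rewrite ler_pM2r//; apply: (le_trans PsiPhi); rewrite ler_pM2l//.
  exact: mulr_gt0.
have -> : c1 * (Phi t / t) * (t * m) = Phi t * m * (B * Psi C) * K.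
  by rewrite /c1; field; rewrite gt_eqF.
rewrite -!mulrA !ler_pM2l ?(young_gt0 yPsi C0)//.
by rewrite mulrC; exact: K_bound.
Qed.

Lemma level_set (I : finType) (a : I -> 'I_d -> R) (l : I -> R) (A : {set I}) t :
  0 < t -> (forall i, 0 < l i) -> (forall i, i \in A -> 2 * t < avg (a i) (l i)) ->
  ((Psi t)%:E *
    wmeas omega [set x | exists2 i, i \in A & cube (a i) (l i) x] <=
   (c1 * (Phi t / t))%:E * \int[lebesgue]_x (tail t x * sigma x)%:E)%E.
Proof.
move=> t0 l0 high; have Pt := young_gt0 yPsi t0.
have [S [SA disj cov]] := vitali_cubes a A l0.
set E := [set x | _].
have EV : (wmeas omega E <=
    (\sum_(i in S) mass omega (fun k => a i k - l i) (3 * l i))%:E)%E.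
  apply: (wmeas_vitali wo l0) => x [i iA Qx].
  by have [j jS sub] := cov _ iA; exists j => //; exact: sub.
apply: (@le_trans _ _ ((Psi t)%:E *
    (\sum_(i in S) mass omega (fun k => a i k - l i) (3 * l i))%:E)%E).
  by apply: lee_wpmul2l => //; rewrite lee_fin ltW.
rewrite -EFinM mulr_sumr -sumEFin.
have c0 : 0 <= c1 * (Phi t / t).
  by rewrite mulr_ge0 ?c1_ge0// divr_ge0 ?(ltW t0)// young_ge0// ltW.
apply: (@le_trans _ _ (\sum_(i in S) (c1 * (Phi t / t))%:E *
    \int[lebesgue]_(x in cube (a i) (l i)) (tail t x * sigma x)%:E)%E).
  apply: lee_sum => i iS; apply: cube_level => //.
  exact/high/(fintype.subsetP SA).
rewrite -ge0_sume_distrr; last first.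
  by move=> i _; apply: integral_ge0 => x _; exact/density_ge0/tail_ge0.
apply: lee_wpmul2l; first by rewrite lee_fin.
apply: le_sum_integral_disjoint.
- by move=> i; exact: measurable_cube.
- by move=> x; exact/density_ge0/tail_ge0.
- exact/measurable_density/measurable_tail.
- exact: measurableT.
- by [].
- exact: disj.
Qed.

Context (D : R) (D0 : 0 < D).
Hypothesis lacunary : forall t0 m u, 0 < t0 -> 0 <= u ->
  \sum_(i < m | t0 * 2 ^+ i < u) Phi (t0 * 2 ^+ i) / (t0 * 2 ^+ i) * u
    <= D * Phi u.
Context (a : nat -> 'I_d -> R) (l : nat -> R) (l0 : forall k, 0 < l k).

Let v k := avg (a k) (l k).
Let Q k : set (euclid R d) := cube (a k) (l k).

Fixpoint finite_max N x : R :=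
  if N is N'.+1 then Num.max (finite_max N' x) (v N' * \1_(Q N') x) else 0.

Lemma finite_max_ge0 N x : 0 <= finite_max N x.
Proof.
by elim: N => //= N IH; rewrite le_max IH.
Qed.

Lemma finite_max_mono x : {homo finite_max^~ x : n m / (n <= m)%N >-> n <= m}.
Proof.
apply: homo_leq => [n|n m p|n]; [exact: lexx|exact: le_trans|].
by rewrite /= le_max lexx.
Qed.

Lemma le_finite_max N k x : (k < N)%N -> Q k x -> v k <= finite_max N x.
Proof.
move=> kN Qx; apply: le_trans (finite_max_mono x kN).
by rewrite /= le_max indicE mem_set// mulr1 lexx orbT.
Qed.

Lemma finite_max_attained N x : finite_max N x = 0 \/
  exists2 k : 'I_N, Q k x & finite_max N x = v k.
Proof.
elim: N => [|N IH]; first by left.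
rewrite /= maxEle; case: ifP => _.
  rewrite indicE; have [/set_mem Qx|_] := boolP (x \in Q N).
    by right; exists ord_max; rewrite // mulr1.
  by left; rewrite mulr0.
case: IH => [->|[k Qx ->]]; first by left.
by right; exists (widen_ord (leqnSn N) k).
Qed.

Lemma measurable_finite_max N : measurable_fun setT (finite_max N).
Proof.
elim: N => [|N IH] /=; first exact: measurable_cst.
apply: (measurable_maxr IH).
exact/(measurable_funM (measurable_cst _))/measurable_indic/measurable_cube.
Qed.

Lemma dyadic_bracket (s u : R) m : s < u -> u <= s * 2 ^+ m ->
  exists2 i : 'I_m, s * 2 ^+ i < u & u <= s * 2 ^+ i.+1.
Proof.
elim: m => [|m IH] su; first by rewrite expr0 mulr1 leNgt su.
have [um _|mu um] := leP u (s * 2 ^+ m); last by exists ord_max.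
by have [i ui iu] := IH su um; exists (widen_ord (leqnSn m) i).
Qed.

(** Finitely many averages meet only finitely many dyadic levels. *)
Lemma scale_range N : exists t0 m, 0 < t0 /\
  forall k : 'I_N, v k = 0 \/ 2 * t0 < v k <= 2 * t0 * 2 ^+ m.
Proof.
pose q := \big[Num.max/1]_(k < N) (v k)^-1.
have q1 : 1 <= q by exact: bigmax_ge_id.
have q0 : 0 < q by exact: lt_le_trans q1.
pose V := \big[Num.max/0]_(k < N) v k.
pose t0 := q^-1 / 4.
have t00 : 0 < t0 by rewrite divr_gt0 ?invr_gt0.
exists t0, (Num.truncn (V / (2 * t0))).+1; split=> // k.
have := avg_ge0 (a k) (l0 k); rewrite le_eqVlt => /predU1P[vk|]; first by left.
rewrite -/(v k) => vk0; right; apply/andP; split.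
  have qv : q^-1 <= v k.
    rewrite -[leRHS]invrK lef_pV2 ?posrE ?invr_gt0//.
    exact: (@le_bigmax _ _ _ _ (fun k : 'I_N => (v k)^-1)).
  have : 0 < q^-1 by rewrite invr_gt0.
  by rewrite /t0; lra.
have vV : v k <= V by exact: (@le_bigmax _ _ _ _ (fun k : 'I_N => v k)).
move: (v k) vV => u uV; have t20 : 0 < 2 * t0 by rewrite mulr_gt0.
rewrite [leRHS]mulrC -ler_pdivrMr//.
apply: (@le_trans _ _ (V / (2 * t0))); first by rewrite ler_pM2r ?invr_gt0.
apply: (le_trans (ltW (truncnS_gt _))).
by rewrite -natrX ler_nat; apply: ltnW; exact: ltn_expl.
Qed.

(** A point where the maximum lies in ]2 t_i, 4 t_i] belongs to the i-th level
    set E_i.  The level set estimates are then added up under the integral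
    sign, where the levels below g(x) form a lacunary sum. *)
Lemma integral_finite_max N :
  (\int[lebesgue]_x (Psi (finite_max N x) * omega x)%:E <=
    (B * Psi 4 * c1 * D)%:E)%E.
Proof.
have [t0 [m [t00 range]]] := scale_range N.
have [w0 mw _] := wo.
have P4 : 0 < Psi 4 by exact: young_gt0.
pose t i := t0 * 2 ^+ i.
have tgt0 i : 0 < t i by rewrite mulr_gt0// exprn_gt0.
pose A i := [set k : 'I_N | 2 * t i < v k]%SET.
pose E i := [set x : euclid R d | exists2 k : 'I_N, k \in A i & cube (a k) (l k) x].
have mE i : measurable (E i).
  have -> : E i = \big[setU/set0]_(k in A i) cube (a k) (l k).
    rewrite -bigcup_seq_cond; apply/seteqP; split => x.
      by move=> [k kA Qx]; exists k => //=; rewrite mem_index_enum.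
    by move=> [k /= /andP[_ kA] Qx]; exists k.
  by apply: bigsetU_measurable => k _; exact: measurable_cube.
have pointwise x : Psi (finite_max N x) <=
    \sum_(i < m) B * Psi 4 * Psi (t i) * \1_(E i) x.
  have term_ge0 (i : 'I_m) : 0 <= B * Psi 4 * Psi (t i) * \1_(E i) x.
    by rewrite !mulr_ge0 ?(ltW B0) ?(ltW P4)// ltW// young_gt0.
  have [->|[k Qx ->]] := finite_max_attained N x.
    by rewrite young0//; apply: sumr_ge0 => i _; exact: term_ge0.
  case: (range k) => [vk0|/andP[lo hi]].
    have -> : v k = 0 by exact: vk0.
    by rewrite young0//; apply: sumr_ge0 => i _; exact: term_ge0.
  have [i iv vi] := dyadic_bracket lo hi.
  rewrite (bigD1 i)//= -[leLHS]addr0; apply: lerD; last first.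
    by apply: sumr_ge0 => j _; exact: term_ge0.
  rewrite indicE mem_set; last by exists k => //; rewrite inE /t mulrA.
  rewrite mulr1 -mulrA; apply: le_trans (quasi_mult_upper yPsi qm _ (ltW (tgt0 i))) => //.
  apply: young_le => //; first exact: avg_ge0.
  suff -> : 4 * t i = 2 * t0 * 2 ^+ i.+1 by exact: vi.
  by rewrite /t exprS; ring.
pose c i := B * Psi 4 * Psi (t i).
have c0 i : 0 <= c i by rewrite !mulr_ge0 ?(ltW B0) ?(ltW P4)// ltW// young_gt0.
apply: (@le_trans _ _ (\int[lebesgue]_x
    \sum_(i < m) ((c i)%:E * ((\1_(E i) x)%:E * (omega x)%:E)))%E).
  apply: ge0_le_integral_any => x _.
    by rewrite lee_fin mulr_ge0// young_ge0// finite_max_ge0.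
  under eq_bigr do rewrite -!EFinM mulrA.
  by rewrite sumEFin lee_fin -mulr_suml ler_wpM2r.
have mEw i : measurable_fun setT (fun x => (\1_(E i) x)%:E * (omega x)%:E)%E.
  under eq_fun do rewrite -EFinM.
  by apply/measurable_EFinP; apply: measurable_funM => //; exact: measurable_indic.
have Ew0 i x : (0 <= (\1_(E i) x)%:E * (omega x)%:E)%E.
  by rewrite -EFinM lee_fin mulr_ge0.
rewrite ge0_integral_sum; last 3 first.
- exact: measurableT.
- by move=> i; apply: measurable_funeM; exact: mEw.
- by move=> i x _; rewrite mule_ge0// lee_fin c0.
have levelE (i : 'I_m) : (\int[lebesgue]_x ((c i)%:E * ((\1_(E i) x)%:E * (omega x)%:E)) =
    (c i)%:E * wmeas omega (E i))%E.
  rewrite ge0_integralZl_EFin;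
    [|exact: measurableT|by move=> x _; exact: Ew0|exact: mEw|exact: c0].
  congr (_ * _)%E; rewrite /wmeas [RHS]integral_mkcond; apply: eq_integral => x _.
  rewrite patchE indicE; have [_|_] := boolP (x \in E i); first by rewrite mul1e.
  by rewrite mul0e.
under eq_bigr do rewrite levelE.
have B4 : 0 <= B * Psi 4 by rewrite mulr_ge0// ltW.
have tail_phi0 i x : 0 <= Phi (t i) / t i * tail (t i) x.
  by rewrite mulr_ge0 ?tail_ge0// divr_ge0 ?(ltW (tgt0 _))// young_ge0// ltW.
have mtail i : measurable_fun setT (fun x => Phi (t i) / t i * tail (t i) x).
  exact: (measurable_funM (measurable_cst _) (measurable_tail _)).
apply: (@le_trans _ _ (\sum_(i < m) (B * Psi 4 * c1)%:E *
    \int[lebesgue]_x (Phi (t i) / t i * tail (t i) x * sigma x)%:E)%E).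
  apply: lee_sum => i _.
  rewrite (EFinM (B * Psi 4) (Psi (t i))) (EFinM (B * Psi 4) c1) -!muleA.
  apply: lee_wpmul2l; first by rewrite lee_fin.
  have := @level_set 'I_N (fun k => a k) (fun k => l k) (A i) (t i) (tgt0 i).
  move=> /(_ (fun k => l0 k)); rewrite -/(E i) => h.
  apply: (le_trans (h _)) => [k|]; first by rewrite inE.
  rewrite (EFinM c1) -muleA; apply: lee_wpmul2l; first by rewrite lee_fin c1_ge0.
  rewrite -integral_densityZ.
  - rewrite le_eqVlt; apply/orP; left; apply/eqP; apply: eq_integral => x _.
    by rewrite -EFinM mulrA.
  - by rewrite divr_ge0 ?(ltW (tgt0 _))// young_ge0// ltW.
  - exact: tail_ge0.
  - exact: measurable_tail.
rewrite -ge0_sume_distrr; last first.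
  by move=> i _; apply: integral_ge0 => x _; exact: density_ge0 (tail_phi0 i).
rewrite -ge0_integral_sum; last 3 first.
- exact: measurableT.
- by move=> i; exact: measurable_density (mtail i).
- by move=> i x _; exact: density_ge0 (tail_phi0 i).
rewrite (EFinM _ D); apply: lee_wpmul2l; first by rewrite lee_fin mulr_ge0 ?c1_ge0.
apply: (@le_trans _ _ (\int[lebesgue]_x (D%:E * (Phi (g x) * sigma x)%:E))%E).
  apply: ge0_le_integral_any => x _.
    by apply: sume_ge0 => i _; exact: density_ge0 (tail_phi0 i).
  have [s0 _ _] := w.
  rewrite sumEFin -EFinM lee_fin -mulr_suml mulrA ler_wpM2r//.
  apply: le_trans (lacunary m t00 (g0 x)); rewrite [leRHS]big_mkcond/=.
  apply: ler_sum => i _; rewrite /tail -/(t i).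
  by case: ifP => // _; rewrite mulr0.
rewrite integral_densityZ; [|exact: ltW| |].
- by rewrite -[leRHS]mule1; apply: lee_wpmul2l => //; rewrite lee_fin ltW.
- by move=> x; exact: young_ge0.
- exact: young_measurable.
Qed.

End level_sets.

End one_function.

(** * One function: the maximal operator over all cubes *)

Section rational_cubes.
Context {R : realType} {d : nat}.

(** A numbering of cubes with rational data; the default values only serve to
    keep every side positive. *)
Definition rational_cube k : ('I_d -> R) * R :=
  if (unpickle k : option ({ffun 'I_d -> rat} * rat)) is Some (q, r) then
    (fun i => ratr (q i), if 0 < (ratr r : R) then ratr r else 1)
  else (fun=> 0, 1).

Definition corner k := (rational_cube k).1.
Definition side k := (rational_cube k).2.

Lemma side_gt0 k : 0 < side k.
Proof.
by rewrite /side /rational_cube; case: unpickle => [[q r]|]//=; case: ifP.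
Qed.

Lemma rational_hull (a : 'I_d -> R) l : 0 < l -> exists k,
  (cube a l : set (euclid R d)) `<=` cube (corner k) (side k) /\ side k <= 2 * l.
Proof.
move=> l0.
have /choice[q qP] : forall i, exists q : rat, ratr q \in `]a i - l / 4, a i[.
  by move=> i; apply: rat_in_itvoo; lra.
have [r] : exists r : rat, ratr r \in `](5 / 4 * l), (2 * l)[.
  by apply: rat_in_itvoo; lra.
rewrite in_itv/= => /andP[rl rr].
exists (pickle ([ffun i => q i], r)).
have r0 : 0 < (ratr r : R) by apply: lt_trans rl; lra.
rewrite /corner /side /rational_cube pickleK/= r0; split; last exact: ltW.
by apply: subset_cube => i; have := qP i; rewrite ffunE in_itv/=; lra.
Qed.

End rational_cubes.

Section sufficiency.
Context {R : realType} {d : nat}.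
Implicit Types (f : euclid R d -> R[i]) (sigma : euclid R d -> R).

Definition maximal1 sigma f x : \bar R := ereal_sup
  [set ((\1_Q x)%:E / wmeas sigma Q *
       \int[lebesgue]_(y in Q) (modulus f y * (sigma y)%:E))%E | Q in cubes].

Lemma measurable_normc f : Defs.measurableC f ->
  measurable_fun setT (fun x => Normc.normc (f x)).
Proof.
move=> [mRe mIm].
have -> : (fun x => Normc.normc (f x)) =
    Num.sqrt \o (fun x => complex.Re (f x) ^+ 2 + complex.Im (f x) ^+ 2).
  by apply/funext => x /=; case: (f x).
apply: measurableT_comp.
  by apply: continuous_measurable_fun; exact: sqrt_continuous.
exact: (measurable_funD (measurable_funX _ mRe) (measurable_funX _ mIm)).
Qed.

Section one_weight.
Context (Phi Psi : R -> R) (sigma : euclid R d -> R) (B C D : R).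
Hypotheses (yPhi : young Phi) (yPsi : young Psi).
Hypotheses (B0 : 0 < B) (qm : quasi_mult B Psi).
Hypothesis ratio : nondecreasing_pos (fun t => Psi t / Phi t).
Hypothesis w : nweight sigma.
Hypothesis C1 : 1 < C.
Hypothesis mass_dbl : forall a l a' l', 0 < l -> 0 < l' ->
  (cube a l : set (euclid R d)) `<=` cube a' l' -> l' <= 2 * l ->
  mass sigma a' l' <= C * mass sigma a l.
Hypothesis mass_tripled : forall a l, 0 < l ->
  mass sigma (fun i => a i - l) (3 * l) <= C * mass sigma a l.
Hypothesis D0 : 0 < D.
Hypothesis lacunary : forall t0 m u, 0 < t0 -> 0 <= u ->
  \sum_(i < m | t0 * 2 ^+ i < u) Phi (t0 * 2 ^+ i) / (t0 * 2 ^+ i) * u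
    <= D * Phi u.
Context (omega : euclid R d -> R) (K : R) (wo : nweight omega).
Hypothesis K_bound : forall a l, 0 < l ->
  mass omega a l * Psi (ginv Phi (mass sigma a l)^-1) <= K.

Let C0 : 0 < C. Proof. exact: lt_trans C1. Qed.

Section fixed_function.
Context f (mf : Defs.measurableC f) (lam lam0 : R) (lam_gt0 : 0 < lam) (lam0_gt0 : 0 < lam0).
Hypothesis f1 : (\int[lebesgue]_x
  (er_map Phi (`|modulus f x| / lam%:E) * (sigma x)%:E) <= 1)%E.

Let g x := Normc.normc (f x) / lam.
Let M := finite_max sigma g (@corner R d) (@side R d).

Let g0 x : 0 <= g x.
Proof. by rewrite divr_ge0 ?normc_ge0// ltW. Qed.

Let mg : measurable_fun setT g.
Proof. exact: (measurable_funM (measurable_normc mf) (measurable_cst _)). Qed.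

Let g1 : (\int[lebesgue]_x (Phi (g x) * sigma x)%:E <= 1)%E.
Proof.
apply: le_trans f1; rewrite le_eqVlt; apply/orP; left; apply/eqP.
apply: eq_integral => x _.
by rewrite /modulus inver gt_eqF//= ger0_norm ?normc_ge0// EFinM.
Qed.

Lemma maximal1_ge0 x : (0 <= maximal1 sigma f x)%E.
Proof.
pose Q := (cube (fun=> 0) 1 : set (euclid R d)).
apply: le_ereal_sup_tmp; exists ((\1_Q x)%:E / wmeas sigma Q *
    \int[lebesgue]_(y in Q) (modulus f y * (sigma y)%:E))%E.
  by exists Q => //; exists (fun=> 0), 1.
have [s0 _ _] := w; rewrite massE// inver gt_eqF ?mass_gt0//.
apply: mule_ge0.
  by rewrite lee_fin mulr_ge0// invr_ge0 ltW// mass_gt0.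
by apply: integral_ge0 => y _; rewrite lee_fin mulr_ge0 ?normc_ge0.
Qed.

(** The average over a cube is at most C times the average over its rational
    hull, by doubling. *)
Lemma maximal1_le x s : (forall N, M N x <= s) ->
  (maximal1 sigma f x <= (lam * (C * s))%:E)%E.
Proof.
move=> Ms; apply: ge_ereal_sup => _ [_ [a [l [l0 ->]]] <-].
have s0 : 0 <= s by apply: le_trans (Ms 0%N); exact: finite_max_ge0.
have m0 := mass_gt0 w a l0; have [sg0 ms _] := w.
have intE : (\int[lebesgue]_(y in cube a l) (modulus f y * (sigma y)%:E) =
    lam%:E * \int[lebesgue]_(y in cube a l) (g y * sigma y)%:E)%E.
  rewrite -ge0_integralZl_EFin.
  - apply: eq_integral => y _; rewrite -!EFinM mulrA /g mulrCA divff ?gt_eqF//.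
    by rewrite mulr1.
  - exact: measurable_cube.
  - by move=> y _; exact: density_ge0.
  - exact/measurable_funTS/measurable_density.
  - exact: ltW.
rewrite intE (integral_cubeE yPhi w g0 mg g1 a l0) massE// inver gt_eqF//.
rewrite -!EFinM lee_fin.
have -> : \1_(cube a l) x / mass sigma a l * (lam * (avg sigma g a l * mass sigma a l)) =
    lam * (\1_(cube a l) x * avg sigma g a l) by field; rewrite gt_eqF.
rewrite ler_pM2l// indicE; have [/set_mem Qx|_] := boolP (x \in cube a l); last first.
  by rewrite mul0r mulr_ge0// ltW.
rewrite mul1r; have [k [sub sidek]] := rational_hull a l0.
have k0 := @side_gt0 R d k; have mk0 := mass_gt0 w (@corner R d k) k0.
apply: (@le_trans _ _ (C * avg sigma g (@corner R d k) (@side R d k))); last first.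
  rewrite ler_pM2l//; apply: le_trans (Ms k.+1).
  by rewrite /M; apply: le_finite_max; [exact: ltnSn|exact: sub].
have int_le : avg sigma g a l * mass sigma a l <=
    avg sigma g (@corner R d k) (@side R d k) * mass sigma (@corner R d k) (@side R d k).
  rewrite -lee_fin -(integral_cubeE yPhi w g0 mg g1 a l0).
  rewrite -(integral_cubeE yPhi w g0 mg g1 (@corner R d k) k0).
  apply: ge0_subset_integral; [exact: measurable_cube|exact: measurable_cube| | |exact: sub].
    exact/measurable_funTS/measurable_density.
  by move=> y _; exact: density_ge0.
rewrite -(ler_pM2r m0); apply: (le_trans int_le).
rewrite [leRHS]mulrAC [leRHS]mulrC; apply: ler_wpM2l; last exact: mass_dbl.
exact: (avg_ge0 w g0 _ k0).
Qed.

(** The limit of the finite maxima is a measurable majorant, which quasi-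
    multiplicativity relates to the maximal function divided by lam0. *)
Lemma integral_maximal1 :
  (\int[lebesgue]_x (er_map Psi (`|maximal1 sigma f x| / (lam0 * lam)%:E) *
     (omega x)%:E) <=
   (B * B * Psi C / Psi lam0 * (B * Psi 4 * (B * Psi C * K) * D))%:E)%E.
Proof.
have [w0 mw _] := wo.
set e := B * B * Psi C / Psi lam0.
have PC := young_gt0 yPsi C0; have Pl := young_gt0 yPsi lam0_gt0.
have e0 : 0 < e by rewrite divr_gt0// !mulr_gt0.
pose u N x := (e%:E * (Psi (M N x) * omega x)%:E)%E.
have M0 N x : 0 <= M N x by exact: finite_max_ge0.
have PM0 N x : 0 <= Psi (M N x) by exact: young_ge0.
have mPM N : measurable_fun setT (fun x => (Psi (M N x) * omega x)%:E).
  apply/measurable_EFinP/measurable_funM; last exact: mw.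
  exact: (young_measurable yPsi (M0 N) (measurable_finite_max _ _ _ _ _)).
have PMw0 N x : (0 <= (Psi (M N x) * omega x)%:E)%E by rewrite lee_fin mulr_ge0.
have u0 N x : (0 <= u N x)%E by rewrite mule_ge0// lee_fin ltW.
have mu N : measurable_fun setT (u N) by exact/measurable_funeM/mPM.
have u_mono x : {homo u^~ x : n m / (n <= m)%N >-> (n <= m)%E}.
  move=> n m nm; rewrite /u lee_wpmul2l ?lee_fin ?(ltW e0)//.
  by rewrite ler_wpM2r// young_le// finite_max_mono.
have limE x : limn (u^~ x) = ereal_sup (range (u^~ x)).
  exact/cvg_lim/ereal_nondecreasing_cvgn/u_mono.
apply: (@le_trans _ _ (\int[lebesgue]_x limn (u^~ x))%E); last first.
  rewrite monotone_convergence; [|exact: measurableT|exact: mu|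
    by move=> n x _; exact: u0|by move=> x _; exact: u_mono].
  apply: lime_le.
    apply: ereal_nondecreasing_is_cvgn => n m nm.
    by apply: ge0_le_integral_any => x _; [exact: u0|exact: u_mono].
  apply: nearW => N; rewrite /u (EFinM e) ge0_integralZl_EFin;
    [|exact: measurableT|by move=> x _; exact: PMw0|exact: mPM|exact: ltW].
  apply: lee_wpmul2l; first by rewrite lee_fin ltW.
  exact: (integral_finite_max yPhi yPsi B0 qm ratio w C1 mass_tripled g0 mg g1
    wo K_bound D0 lacunary (@corner R d) (@side_gt0 R d) N).
have ll0 : 0 < lam0 * lam by rewrite mulr_gt0.
apply: ge0_le_integral_any => x _.
  rewrite mule_ge0 ?lee_fin// er_map_ge0// mule_ge0// inver gt_eqF// lee_fin.
  by rewrite invr_ge0 ltW.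
rewrite limE; have sup0 : (0 <= ereal_sup (range (u^~ x)))%E.
  by apply: le_ereal_sup_tmp; exists (u 0%N x) => //; exists 0%N.
(* If the majorant is finite at x, it bounds the finite maxima by s. *)
have [wx|wx] := eqVneq (omega x) 0; first by rewrite wx mule0.
have wx0 : 0 < omega x by rewrite lt_def wx w0.
have ub N : (u N x <= ereal_sup (range (u^~ x)))%E.
  by apply: ereal_sup_ubound; exists N.
case: (ereal_sup _) sup0 ub => [r| |]; [|by move=> *; exact: leey|by []].
rewrite lee_fin => r0 ub.
pose r' := r / (e * omega x).
have r'0 : 0 <= r' by rewrite divr_ge0// mulr_ge0// ltW.
pose s := ginv Psi r'.
have s0 : 0 <= s by exact: ginv_ge0.
have Ms N : M N x <= s.
  apply: (le_ginv yPsi) r'0; rewrite /r' ler_pdivlMr; last by rewrite mulr_gt0.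
  by rewrite mulrCA -lee_fin EFinM; exact: ub.
have := maximal1_le Ms; have := maximal1_ge0 x.
case: (maximal1 sigma f x) => [y| |]//; rewrite !lee_fin => y0 yle.
rewrite inver gt_eqF//= ger0_norm// -?EFinM lee_fin.
have -> : r = e * r' * omega x.
  by rewrite /r'; field; rewrite !gt_eqF.
rewrite ler_pM2r//.
have Cs0 : 0 <= C * s by rewrite mulr_ge0// ltW.
apply: (@le_trans _ _ (Psi (C * s / lam0))).
  apply: young_le => //; first by rewrite divr_ge0// ltW.
  rewrite ler_pdivrMr//; apply: (le_trans yle).
  rewrite le_eqVlt; apply/orP; left; apply/eqP; field.
  by rewrite gt_eqF.
apply: (le_trans (quasi_mult_div yPsi qm Cs0 lam0_gt0)).
have := quasi_mult_upper yPsi qm (ltW C0) s0; rewrite [X in _ <= _ * (_ * X)]ginvK// => h.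
have -> : e * r' = B * (B * (Psi C * r')) / Psi lam0 by rewrite /e; ring.
by rewrite ler_pM2r ?invr_gt0// ler_pM2l.
Qed.

End fixed_function.
End one_weight.
End sufficiency.

(** * The characterization *)

Section conclusion.
Context {R : realType} {d : nat}.

(** For lam in the set defining the norm of f, the number
    (1 + c3) Psi^-1(K) lam lies in the set defining the norm of the maximal
    function; 1 + c3 is at least 1, so that Psi(lam0) >= c3 K. *)
Lemma maximal1_bounded (Phi Psi : R -> R) (sigma : euclid R d -> R) B :
  young Phi -> nabla2 Phi -> young Psi -> 0 < B -> quasi_mult B Psi ->
  nondecreasing_pos (fun t => Psi t / Phi t) ->
  nweight sigma -> doubling sigma ->
  exists c : R, 0 < c /\ forall (omega : euclid R d -> R) K,
    nweight omega -> 0 < K ->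
    (forall a l, 0 < l ->
      mass omega a l * Psi (ginv Phi (mass sigma a l)^-1) <= K) ->
    forall f, in_Orlicz Phi sigma f ->
    (luxemburg Psi omega (maximal1 sigma f) <=
      (c * ginv Psi K)%:E * luxemburg Phi sigma (modulus f))%E.
Proof.
move=> yPhi n2 yPsi B0 qm ratio w dbl.
have [D [D0 lac]] := nabla2_lacunary_sum yPhi n2.
have [C C1 [md mt]] := mass_triple w dbl.
have C0 : 0 < C by exact: lt_trans C1.
pose c3 := B * B * Psi C * (B * Psi 4 * (B * Psi C) * D).
have P4 : 0 < Psi 4 by exact: young_gt0.
have PC := young_gt0 yPsi C0.
have c30 : 0 < c3 by rewrite !mulr_gt0.
exists (1 + c3); split; first by rewrite addr_gt0.
move=> omega K wo K0 Kb f [mf _].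
have gK0 := ginv_gt0 yPsi K0.
set lam0 := (1 + c3) * ginv Psi K.
have lam00 : 0 < lam0 by rewrite mulr_gt0// addr_gt0.
have Plam : c3 * K <= Psi lam0.
  apply: le_trans (young_star yPsi _ (ltW gK0)); last by rewrite lerDl ltW.
  by rewrite [X in _ <= _ * X]ginvK ?(ltW K0)// mulrDl mul1r lerDr ltW.
rewrite -lee_pdivrMl//; apply: le_ereal_inf_tmp => _ [lam [lam_gt0 int1] <-].
rewrite lee_pdivrMl// -EFinM; apply: ereal_inf_lbound.
exists (lam0 * lam) => //; split; first exact: mulr_gt0.
apply: (le_trans (integral_maximal1 yPhi yPsi B0 qm ratio w C1 md mt D0 lac wo
  Kb mf lam_gt0 lam00 int1)).
have Pl := young_gt0 yPsi lam00.
rewrite lee_fin mulrAC ler_pdivrMr// mul1r; apply: le_trans Plam.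
by rewrite le_eqVlt; apply/orP; left; apply/eqP; rewrite /c3; ring.
Qed.

(** The case n >= 2 of sufficiency is vacuous, the constant being
    infinite. *)
Lemma nweight_characterization n (sigma : 'I_n -> euclid R d -> R)
    (Phi : 'I_n -> R -> R) (Psi : R -> R) B :
  (0 < d)%N -> (0 < n)%N -> (forall i, nweight (sigma i)) ->
  (forall i, young (Phi i)) -> (forall i, nabla2 (Phi i)) ->
  young Psi -> 0 < B -> quasi_mult B Psi ->
  (forall i, nondecreasing_pos (fun t => Psi t / Phi i t)) ->
  (forall i, doubling (sigma i)) ->
  exists c : R, 0 < c /\ forall omega : euclid R d -> R, nweight omega ->
    (bounded_operator (maximal sigma) Phi sigma Psi omega <->
      (K_constant Phi Psi sigma omega < +oo)%E) /\
    (c^-1%:E * er_map (ginv Psi) (K_constant Phi Psi sigma omega) <=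
       operator_norm (maximal sigma) Phi sigma Psi omega)%E /\
    (operator_norm (maximal sigma) Phi sigma Psi omega <=
       c%:E * er_map (ginv Psi) (K_constant Phi Psi sigma omega))%E.
Proof.
move=> d0 n0 ws yPhi n2 yPsi B0 qm ratio dbl.
pose c1 := 1 + B ^+ n.+1 / Psi 1.
have P1 := young_gt0 yPsi ltr01.
have B1 : 0 < B ^+ n.+1 / Psi 1 by rewrite divr_gt0 ?exprn_gt0.
have c10 : 0 < c1 by rewrite addr_gt0.
have nec omega C : nweight omega -> 0 < C ->
    bounded_by (maximal sigma) Phi sigma Psi omega C ->
    (er_map (ginv Psi) (K_constant Phi Psi sigma omega) <= (c1 * (2 * C))%:E)%E.
  move=> wo C0 bC; have := necessity yPhi yPsi B0 qm ws wo C0 bC.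
  have := K_constant_le Phi Psi (fun=> 0) ws wo ltr01.
  have kt0 := K_term_gt0 (fun=> 0) yPhi yPsi ws wo ltr01.
  have C20 : 0 <= 2 * C by rewrite mulr_ge0// ltW.
  case: K_constant => [k| |]//; rewrite /= !lee_fin => kt kC.
  apply: (ginv_le yPsi); last by rewrite (le_trans _ kt)// ltW.
    by rewrite mulr_ge0// ltW.
  apply: (le_trans kC); apply: le_trans (young_star yPsi _ C20); last first.
    by rewrite lerDl ltW.
  by rewrite [leRHS]mulrDl mul1r lerDr young_ge0.
have [cs [cs0 suf]] : exists cs : R, 0 < cs /\ forall omega k, nweight omega ->
    K_constant Phi Psi sigma omega = k%:E ->
    0 < cs * ginv Psi k /\
    bounded_by (maximal sigma) Phi sigma Psi omega (cs * ginv Psi k).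
  move: n0; rewrite leq_eqVlt => /predU1P[n1|n1]; last first.
    exists 1; split => // omega k wo.
    by rewrite (K_constant_infinite d0 n1 yPhi yPsi ratio ws dbl wo).
  subst n; have [cs [cs0 H]] := maximal1_bounded (yPhi ord0) (n2 ord0) yPsi B0 qm
    (ratio ord0) (ws ord0) (dbl ord0).
  exists cs; split => // omega k wo Kk.
  have Kb a l : 0 < l -> K_term Phi Psi sigma omega a l <= k.
    by move=> l0; rewrite -lee_fin -Kk; exact: K_constant_le.
  have k0 : 0 < k.
    exact: lt_le_trans (K_term_gt0 (fun=> 0) yPhi yPsi ws wo ltr01) (Kb _ _ ltr01).
  split; first by rewrite mulr_gt0// ginv_gt0.
  move=> f fO; rewrite big_ord1.
  have -> : maximal sigma f = maximal1 (sigma ord0) (f ord0).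
    apply/funext => x; rewrite /maximal /maximal1; congr ereal_sup.
    by apply: eq_imagel => Q _; rewrite big_ord1.
  apply: H => // a l l0; have := Kb a l l0.
  by rewrite /K_term big_ord1.
pose c := c1 * 2 + cs.
have c0 : 0 < c by rewrite addr_gt0// mulr_gt0.
have K_ge0 omega : nweight omega -> (0 <= K_constant Phi Psi sigma omega)%E.
  move=> wo; apply: le_trans (K_constant_le Phi Psi (fun=> 0) ws wo ltr01).
  by rewrite lee_fin ltW// K_term_gt0.
exists c; split => // omega wo; split; [split|split].
- move=> [C [C0 bC]]; have := nec _ _ wo C0 bC.
  by case: K_constant => // k _; exact: ltry.
- have := K_ge0 _ wo; case E: K_constant => [k| |]// _ _.
  by have [? ?] := suf _ _ wo E; exists (cs * ginv Psi k).
- apply: le_ereal_inf_tmp => _ [C [C0 bC] <-].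
  rewrite lee_pdivrMl//; apply: (le_trans (nec _ _ wo C0 bC)).
  by rewrite -EFinM lee_fin mulrA ler_pM2r// lerDl ltW.
- have := K_ge0 _ wo; case E: K_constant => [k| |]// k0.
    have [cg0 bd] := suf _ _ wo E.
    apply: (@le_trans _ _ (cs * ginv Psi k)%:E).
      by apply: ereal_inf_lbound; exists (cs * ginv Psi k).
    rewrite /= -EFinM lee_fin ler_wpM2r ?lerDr ?mulr_ge0 ?(ltW c10)//.
    by rewrite ginv_ge0.
  by rewrite /= gt0_muley ?lte_fin// leey.
Qed.

End conclusion.

Theorem theorem3p6 (R : realType) (d n : nat)
    (sigma : 'I_n -> euclid R d -> R) (Phi : 'I_n -> R -> R) (Psi : R -> R)
    (d_gt0 : (0 < d)%N) (n_gt0 : (0 < n)%N)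
    (sigma_weight : forall i, weight (sigma i))
    (Phi_class : forall i, class_U (Phi i) /\ nabla2 (Phi i))
    (Psi_class : class_Utilde Psi)
    (ratio_nondecreasing :
      forall i, nondecreasing_pos (fun t => Psi t / Phi i t))
    (sigma_doubling : forall i, doubling (sigma i)) :
  exists c : R, 0 < c /\
    forall omega : euclid R d -> R, weight omega ->
      (bounded_operator (maximal sigma) Phi sigma Psi omega <->
        (K_constant Phi Psi sigma omega < +oo)%E) /\
      (c^-1%:E * er_map (ginv Psi) (K_constant Phi Psi sigma omega) <=
         operator_norm (maximal sigma) Phi sigma Psi omega)%E /\
      (operator_norm (maximal sigma) Phi sigma Psi omega <=
         c%:E * er_map (ginv Psi) (K_constant Phi Psi sigma omega))%E.
Proof.
have yPhi i : young (Phi i) by exact: class_U_young (Phi_class i).1.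
have [yPsi [B [B0 qm]]] := class_Utilde_quasi_mult Psi_class.
have [c [c0 H]] := nweight_characterization d_gt0 n_gt0
  (fun i => weight_pos_part (sigma_weight i)) yPhi (fun i => (Phi_class i).2)
  yPsi B0 qm ratio_nondecreasing
  (fun i => doubling_pos_part (sigma_weight i) (sigma_doubling i)).
exists c; split => // omega w.
have bE C := bounded_by_pos_part C sigma_weight w yPhi yPsi.
have setE : [set C : R | 0 < C /\ bounded_by (maximal (fun i => pos_part (sigma i)))
      Phi (fun i => pos_part (sigma i)) Psi (pos_part omega) C] =
    [set C : R | 0 < C /\ bounded_by (maximal sigma) Phi sigma Psi omega C].
  apply/seteqP; split => C [C0 bC]; (split; [exact: C0|]).
    exact: (iffLR (bE C) bC).
  exact: (iffRL (bE C) bC).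
have normE : operator_norm (maximal (fun i => pos_part (sigma i))) Phi
    (fun i => pos_part (sigma i)) Psi (pos_part omega) =
    operator_norm (maximal sigma) Phi sigma Psi omega.
  exact (f_equal (fun A : set R => ereal_inf [set C%:E | C in A]) setE).
have KE := K_constant_pos_part Phi Psi sigma_weight w.
have := H _ (weight_pos_part w); rewrite normE KE => -[bK norms].
split; last exact: norms.
apply: iff_trans bK; split => -[C [C0 bC]]; exists C; (split; [exact: C0|]).
  exact: (iffRL (bE C) bC).
exact: (iffLR (bE C) bC).
Qed.
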